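(* Let $|q|<1$ and $(a,b)$ a pair of coprime integers with $1\leq b<a$. If $a<2b$ then \[ \sum_{m\in\mathbb Z_{\ge0}^d}\frac{q^{m^TCm}}{(q)_{2m_1}}\prod_{j=2}^d\begin{bmatrix}\tau_jm_j+n_j\\ \tau_jm_j\end{bmatrix}_{q^{\bar\tau_j}}=\frac{(q^{ab},q^{ab},q^{2ab};q^{2ab})_\infty}{(q;q)_\infty}, \] and if $a\ge 2b$ then \[ \sum_{\substack{n_1,\dots,n_{a_0}\ge0\\ m_{a_0+1},\dots,m_d\ge0}}\frac{q^{\sum_{i=1}^{a_0}(N_i+m_{a_0+1})^2+\sum_{j,k=a_0+1}^dm_jC_{j,k}m_k}}{(q)_{n_1}\cdots(q)_{n_{a_0-1}}(q^{\bar\tau_{a_0}};q^{\bar\tau_{a_0}})_{n_{a_0}}(q^{\bar\tau_{a_0+1}};q^{\bar\tau_{a_0+1}})_{\tau_{a_0+1}m_{a_0+1}}}\prod_{j=a_0+2}^d\begin{bmatrix}\tau_jm_j+n_j\\ \tau_jm_j\end{bmatrix}_{q^{\bar\tau_j}}=\frac{(q^{ab},q^{ab},q^{2ab};q^{2ab})_\infty}{(q;q)_\infty}. \]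
   Context: Notation: $(x;q)_n=\prod_{i=0}^{n-1}(1-xq^i)$ (also $n=\infty$), $(q)_n=(q;q)_n$, $(x_1,\dots,x_r;q)_\infty=\prod_i(x_i;q)_\infty$; $\begin{bmatrix}N\\ m\end{bmatrix}_q=\frac{(q)_N}{(q)_m(q)_{N-m}}$ if $m,N-m$ are nonnegative integers, $0$ otherwise, and $\begin{bmatrix}N\\ m\end{bmatrix}_{q^k}$ is the same with $q$ replaced by $q^k$. Continued-fraction data: for coprime $1\le b<a$ let $\mathrm{cf}(a,b)=(a/b-1)^{s}$ with $s=1$ if $a>2b$, $s=-1$ if $a<2b$, $s=0$ if $a=2b$. Write $\mathrm{cf}(a,b)=[a_0,\dots,a_n]$ (regular continued fraction with positive integer partial quotients), choosing $a_n\ge 2$ when $(a,b)\ne(2,1)$ (and $\mathrm{cf}(2,1)=[1]$). Put $t_0=0$, $t_j=a_0+\dots+a_{j-1}$ ($1\le j\le n+1$), $d=t_{n+1}$. $\mathcal I$ is the $d\times d$ matrix with $\mathcal I_{j,k}=\delta_{j,k+1}+\delta_{j,k-1}$ if $j\notin\{t_1,\dots,t_{n+1}\}$ and $\delta_{j,k+1}+\delta_{j,k}-\delta_{j,k-1}$ otherwise; $C=2I-\mathcal I$. $\tau_j=2$ for $j<d$, $\tau_d=1$, and $\bar\tau_j=3-\tau_j$. $m^TCm=\sum_{j,k}m_jC_{j,k}m_k$. In the case $a<2b$: $n_j=-\sum_{k=1}^dC_{j,k}m_k$ for $j\ge2$. In the case $a\ge 2b$: $N_i=n_i+\dots+n_{a_0}$;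 $n_j=-\sum_{k=a_0+1}^dC_{j,k}m_k$ for $j\ge a_0+2$; if $d=a_0$ (exactly when $b=1$) there are no variables $m_{a_0+1},\dots,m_d$, one sets $m_{a_0+1}=0$ (so the corresponding factor $(q^{\bar\tau_{a_0+1}};q^{\bar\tau_{a_0+1}})_0=1$), and the sum over $j,k\ge a_0+1$ and the final product are empty. *)

(* Defs.v *)
From HB Require Import structures.
From mathcomp Require Import all_boot all_order all_algebra.
From mathcomp Require Import all_classical all_reals all_analysis.
From mathcomp Require Import complex.
Set Implicit Arguments.
Unset Strict Implicit.
Unset Printing Implicit Defensive.
Import Order.TTheory GRing.Theory Num.Theory.
Import numFieldNormedType.Exports.
Local Open Scope classical_set_scope.
Local Open Scope ring_scope.

(* The complex numbers over R, seen as a numFieldType (so that the normed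
   topology of MathComp-Analysis is available on it). *)
Notation Cpx R := (R[i] : numFieldType).

Definition qpoch {K : numFieldType} (x y : K) (n : nat) : K :=
  \prod_(i < n) (1 - x * y ^+ i).

Definition qpoch_inf {K : numFieldType} (x y : K) : K :=
  limn (fun n => qpoch x y n).

Definition qbinom {K : numFieldType} (y : K) (N M : int) : K :=
  if (0 <= M) && (M <= N) then
    qpoch y y `|N|%N / (qpoch y y `|M|%N * qpoch y y `|N - M|%N)
  else 0.

Fixpoint cfval (s : seq nat) : rat :=
  match s with
  | [::] => 0
  | [:: x] => x%:R
  | x :: s' => x%:R + (cfval s')^-1
  end.

Definition cf_sign (a b : nat) : int :=
  if (2 * b < a)%N then 1 else if (a < 2 * b)%N then -1 else 0.
Definition cf_target (a b : nat) : rat :=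
  (a%:R / b%:R - 1) ^ (cf_sign a b).

Definition is_cf (a b : nat) (cfl : seq nat) : Prop :=
  [/\ cfl != [::], all (fun x => 0 < x)%N cfl, cfval cfl = cf_target a b &
      (if (a == 2%N) && (b == 1%N) then cfl = [:: 1%N] else (2 <= last 0 cfl)%N)].

Section CFData.
Variable cfl : seq nat.

Definition cf_d : nat := sumn cfl.
Definition cf_t (j : nat) : nat := sumn (take j cfl).
Definition cf_a0 : nat := head 0%N cfl.
Definition in_T (j : nat) : bool := j \in [seq cf_t i | i <- iota 1 (size cfl)].

Definition delta (j k : nat) : int := if j == k then 1 else 0.

(* the matrix \mathcal I (indices j, k in 1..d) *)
Definition cfI (j k : nat) : int :=
  if ~~ in_T j then delta j k.+1 + delta j k.-1 *~ (0 < k)%N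
  else delta j k.+1 + delta j k - delta j k.-1 *~ (0 < k)%N.
Definition cfC (j k : nat) : int := 2 * delta j k - cfI j k.

Definition tau (j : nat) : nat := if (j < cf_d)%N then 2%N else 1%N.
Definition taub (j : nat) : nat := (3 - tau j)%N.
End CFData.

(* A box multi-index f : 'I_d -> 'I_K, read as a 1-based sequence
   (v_1, ..., v_d) of naturals (v_j = 0 outside 1..d). *)
Definition mext (d K : nat) (f : {ffun 'I_d -> 'I_K}) (j : nat) : nat :=
  match j with
  | 0 => 0%N
  | j'.+1 => if (j' < d)%N then \sum_(i < d | val i == j') val (f i) else 0%N
  end.

(* Box partial sum of a family F indexed by Z_{>=0}^d :
   sum over all (v_1, ..., v_d) in [0, K)^d. *)
Definition boxsum {V : nmodType} (d K : nat) (F : (nat -> nat) -> V) : V :=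
  \sum_(f : {ffun 'I_d -> 'I_K}) F (mext f).

Section Summands.
Variables (R : realType) (cfl : seq nat) (q : Cpx R).
Local Notation d := (cf_d cfl).
Local Notation a0 := (cf_a0 cfl).
Local Notation C := (cfC cfl).
Local Notation tau := (tau cfl).
Local Notation taub := (taub cfl).

Definition nA (m : nat -> nat) (j : nat) : int :=
  - \sum_(1 <= k < d.+1) C j k * (m k)%:Z.

Definition summandA (m : nat -> nat) : Cpx R :=
  q ^ (\sum_(1 <= j < d.+1) \sum_(1 <= k < d.+1) (m j)%:Z * C j k * (m k)%:Z)
  / qpoch q q (2 * m 1%N)
  * \prod_(2 <= j < d.+1)
      qbinom (q ^+ taub j) ((tau j * m j)%:Z + nA m j) (tau j * m j)%:Z.

(* Case a >= 2b: v = (n_1, ..., n_{a0}, m_{a0+1}, ..., m_d). *)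
Definition nB (v : nat -> nat) (j : nat) : int :=
  if (j <= a0)%N then (v j)%:Z
  else - \sum_(a0.+1 <= k < d.+1) C j k * (v k)%:Z.

Definition NB (v : nat -> nat) (i : nat) : int := \sum_(i <= l < a0.+1) nB v l.

Definition summandB (v : nat -> nat) : Cpx R :=
  q ^ (\sum_(1 <= i < a0.+1) (NB v i + (v a0.+1)%:Z) ^+ 2
       + \sum_(a0.+1 <= j < d.+1) \sum_(a0.+1 <= k < d.+1)
           (v j)%:Z * C j k * (v k)%:Z)
  / ((\prod_(1 <= i < a0) qpoch q q (v i))
     * qpoch (q ^+ taub a0) (q ^+ taub a0) (v a0)
     * qpoch (q ^+ taub a0.+1) (q ^+ taub a0.+1) (tau a0.+1 * v a0.+1))
  * \prod_(a0.+2 <= j < d.+1)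
      qbinom (q ^+ taub j) ((tau j * v j)%:Z + nB v j) (tau j * v j)%:Z.
End Summands.

Definition rhs (R : realType) (a b : nat) (q : Cpx R) : Cpx R :=
  qpoch_inf (q ^+ (a * b)) (q ^+ (2 * (a * b)))
  * qpoch_inf (q ^+ (a * b)) (q ^+ (2 * (a * b)))
  * qpoch_inf (q ^+ (2 * (a * b))) (q ^+ (2 * (a * b)))
  / qpoch_inf q q.

(* Main.v *)
Require Import Defs.
From HB Require Import structures.
From mathcomp Require Import all_boot all_order all_algebra.
From mathcomp Require Import all_classical all_reals all_analysis.
From mathcomp Require Import complex.
From mathcomp Require Import zify ring.
Set Implicit Arguments.
Unset Strict Implicit.
Unset Printing Implicit Defensive.
Import Order.TTheory GRing.Theory Num.Theory.
Import numFieldNormedType.Exports.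
Local Open Scope classical_set_scope.
Local Open Scope ring_scope.

(** Put B(L,M,a,b) = [L+M+a-b; L+a] [L+M-a+b; L-a]. The Burge transform
    sum_i q^(i^2) [2L+M-i; 2L] B(L-i,i,a,b) = q^(b^2) B(L,M,a+b,b), together with
    the symmetry B(L,M,a,b) = B(M,L,b,a), turns a fermionic formula for
    sum_j (-1)^j q^(a b j^2) B(L,M,a j,b j) into one for (a+b,b) or (a+b,a), that
    is, it performs the steps of the Euclidean algorithm. The seed is
    sum_j (-1)^j q^(j^2) B(L,M,j,j) = [L+M; L]_(q^2). Hence the inner sums of both
    identities, read along the continued fraction from its last entry, are
    evaluated in closed form. The limit M -> oo replaces B by
    1/((q)_(L-aj) (q)_(L+aj)); the outer sums over n_1, ..., n_(a0) iterate
    the Bailey lemma for such expressions, and the last sum over L is done with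
    Tannery's theorem. What remains is sum_j (-1)^j q^(a b j^2) / (q)_oo, and
    this theta series is evaluated by letting L = M -> oo in the seed. *)

(** * Gaussian binomials and the q-Pfaff-Saalschuetz sum *)

(** The limit is taken over cubes [0,K)^d, so it matters which sums are exact inside a cube. The
    closed form of an inner sum vanishes for m_(j+1) > m_j, hence a cube that admits the first inner
    variable already holds the whole sum over the later ones, and only the leading variables need a
    limit. There the cube does cut: grouping by M = n_1 + ... + n_k + m gives weights that agree
    with iterated Bailey sums as soon as M < K and are dominated geometrically, uniformly in K. Both
    identities are instances of one scheme: an inner word of slope (g,e), k outer variables and one
    last variable. The inner word gives the exponent ge; each outer sum and the last sum add g^2, so
    the theta series has base Q = q^(g(e + (k+1)g)). Here k = 0 if a < 2b; if a >= 2b, then k = a_0,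
    or k = a_0 - 1 when a_0 is the only partial quotient and n_(a_0) serves as last variable. In
    every case g(e + (k+1)g) = ab. The binomial sums are proved by Pascal recursions that require
    only 1 - q^n != 0 for n >= 1, so q = 0 stays admissible. *)

Lemma sumrD (V : nmodType) (I : Type) (r : seq I) (P : pred I) (F G : I -> V) :
  \sum_(i <- r | P i) F i + \sum_(i <- r | P i) G i
  = \sum_(i <- r | P i) (F i + G i).
Proof. by rewrite big_split. Qed.

Lemma qpoch0 (K : numFieldType) (x y : K) : qpoch x y 0 = 1.
Proof. by rewrite /qpoch big_ord0. Qed.

Lemma qpochS (K : numFieldType) (x y : K) n :
  qpoch x y n.+1 = qpoch x y n * (1 - x * y ^+ n).
Proof. by rewrite /qpoch big_ord_recr. Qed.

Definition gbin (K : numFieldType) (y : K) (n k : nat) : K :=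
  if (k <= n)%N then qpoch y y n / (qpoch y y k * qpoch y y (n - k)) else 0.

Lemma qbinomE (K : numFieldType) (y : K) (n k : nat) :
  qbinom y n%:Z k%:Z = gbin y n k.
Proof.
rewrite /qbinom /gbin lez_nat /=; case: leqP => // le_kn.
by rewrite subzn // !absz_nat.
Qed.

Section Gauss.
Variables (K : numFieldType) (q : K).
Hypothesis q1 : forall n, 1 - q ^+ n.+1 != 0.
Local Notation qp := (qpoch q q).
Local Notation gb := (gbin q).

Lemma qp_S n : qp n.+1 = qp n * (1 - q ^+ n.+1).
Proof. by rewrite qpochS -exprS. Qed.

Lemma qp_neq0 n : qp n != 0.
Proof. by elim: n => [|n IH]; rewrite ?qpoch0 ?oner_neq0 // qp_S mulf_neq0. Qed.

Lemma gbinn n : gb n n = 1.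
Proof. by rewrite /gbin leqnn subnn qpoch0 mulr1 divff ?qp_neq0. Qed.

Lemma gbin0 n : gb n 0 = 1.
Proof. by rewrite /gbin subn0 qpoch0 mul1r divff ?qp_neq0. Qed.

Lemma gbin_small n k : (n < k)%N -> gb n k = 0.
Proof. by rewrite /gbin ltnNge => /negbTE ->. Qed.

Lemma gbinD m k : gb (m + k) k = qp (m + k) / (qp k * qp m).
Proof. by rewrite /gbin leq_addl addnK. Qed.

Lemma gbin_sub n k : (k <= n)%N -> gb n (n - k) = gb n k.
Proof. by move=> le_kn; rewrite /gbin leq_subr le_kn subKn //; congr (_ / _); exact: mulrC. Qed.

Lemma gbinS n k : gb n.+1 k.+1 = gb n k.+1 + q ^+ (n - k) * gb n k.
Proof.
have [lt_nk|lt_kn|<-] := ltngtP n k.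
- by rewrite !gbin_small ?mulr0 ?addr0 ?ltnS // ltnW.
- rewrite /gbin ltnS (ltnW lt_kn) lt_kn subSS -(subnSK lt_kn) !qp_S.
  move: (qp n) => P; have -> : n.+1 = ((n - k.+1).+1 + k.+1)%N by rewrite addSn subnK.
  move: (n - k.+1)%N => m.
  have := qp_neq0 m; have := qp_neq0 k; have := q1 m; have := q1 k.
  rewrite !exprS exprD !exprS => h1 h2 h3 h4.
  by field; rewrite h1 h2 h3 h4.
- by rewrite !gbinn gbin_small // subnn expr0 mulr1 add0r.
Qed.

Lemma gbinS' n k : gb n.+1 k.+1 = q ^+ k.+1 * gb n k.+1 + gb n k.
Proof.
have [lt_nk|lt_kn|<-] := ltngtP n k.
- by rewrite !gbin_small ?mulr0 ?addr0 ?ltnS // ltnW.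
- rewrite /gbin ltnS (ltnW lt_kn) lt_kn subSS -(subnSK lt_kn) !qp_S.
  move: (qp n) => P; have -> : n.+1 = ((n - k.+1).+1 + k.+1)%N by rewrite addSn subnK.
  move: (n - k.+1)%N => m.
  have := qp_neq0 m; have := qp_neq0 k; have := q1 m; have := q1 k.
  rewrite !exprS exprD !exprS => h1 h2 h3 h4.
  by field; rewrite h1 h2 h3 h4.
- by rewrite !gbinn gbin_small // mulr0 add0r.
Qed.

Definition saal A B c m : K := \sum_(k < m.+1)
  q ^+ (k * (k + c)) * gb A k * gb B (k + c) * gb (A + B + (m - k)) (A + B).

(* Pascal's rule in [A+B+m-k; A+B] lowers m, and in [A; k] it lowers A or trades
   it for a shift of c; this recursion determines the sum. *)
Lemma saalS A B c m : saal A.+1 B c m.+1 =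
  q ^+ (A.+1 + B) * saal A.+1 B c m + saal A B c m.+1
  + q ^+ (A.+1 + c) * saal A B c.+1 m.
Proof.
have E1 : saal A.+1 B c m.+1 = q ^+ (A.+1 + B) * saal A.+1 B c m +
  \sum_(k < m.+2) q ^+ (k * (k + c)) * gb A.+1 k * gb B (k + c)
       * gb (A + B + (m.+1 - k)) (A + B).
  rewrite /saal [LHS]big_ord_recr [X in _ = _ + X]big_ord_recr addrA /=; congr (_ + _).
    rewrite mulr_sumr sumrD; apply: eq_bigr => k _ /=.
    by rewrite addSn addSn subSn ?leq_ord // !addnS gbinS' !addSn /=; ring.
  by rewrite subnn !addn0 !gbinn.
rewrite E1 -!addrA; congr (_ + _).
rewrite [saal A B c m.+1]/saal [LHS]big_ord_recl [X in _ = X + _]big_ord_recl /= !gbin0 -!addrA; congr (_ + _).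
rewrite mulr_sumr sumrD; apply: eq_bigr => k _ /=.
rewrite /bump /= !add1n subSS gbinS addnS.
have [le_kA|lt_Ak] := leqP k A; last first.
  by rewrite !(gbin_small lt_Ak) !mulr0 ?addr0 !mul0r ?mulr0 addr0.
rewrite mulrDr !mulrDl; congr (_ + _); rewrite addSn !mulrA -!exprD.
by congr (_ ^+ _ * _ * _ * _); nia.
Qed.

(** The q-Pfaff-Saalschuetz sum. Induction on A, then on m: the product on the right satisfies the
    recursion of [saalS], and the two sides agree for A = 0 and for m = 0. For B < c both sides
    vanish. *)
Lemma saalE A B c m :
  saal A B c m = gb (A + m + c) m * gb (B + m) (m + c).
Proof.
have [lt_Bc|le_cB] := ltnP B c.
  rewrite [gb (B + m) _]gbin_small 1?addnC ?ltn_add2l // mulr0 /saal big1 // => k _.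
  by rewrite [gb B _]gbin_small ?mulr0 ?mul0r // ltn_addl.
elim: A c m le_cB => [|A IHA] c m le_cB.
  rewrite /saal big_ord_recl big1 ?addr0 /= => [|i _]; last first.
    by rewrite (@gbin_small 0) // mulr0 !mul0r.
  rewrite !add0n mul0n expr0 mul1r gbin0 mul1r subn0.
  rewrite [(B + m)%N]addnC gbinD [(m + c)%N]addnC.
  rewrite /gbin le_cB leq_addl addnK [(c + m)%N]addnC leq_add2l le_cB subnDl.
  have := qp_neq0 m; have := qp_neq0 c; have := qp_neq0 (m + c).
  have := qp_neq0 B; have := qp_neq0 (B - c) => h1 h2 h3 h4 h5.
  by field; rewrite h1 h2 h3 h4 h5.
elim: m => [|m IHm].
  by rewrite /saal big_ord1 /= mul0n expr0 mul1r !addn0 !gbinn !gbin0 mulr1.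
rewrite saalS IHm IHA //.
(* The induction hypothesis asks for c + 1 <= B; in the remaining case B = c both sides are 0. *)
have -> : saal A B c.+1 m = gb (A + m + c.+1) m * gb (B + m) (m + c.+1).
  have [le_c1|] := leqP c.+1 B; first exact: IHA.
  rewrite ltnS => le_Bc; have -> : B = c by lia.
  rewrite [gb (c + m) _]gbin_small ?mulr0; last by lia.
  by rewrite /saal big1 // => k _; rewrite [gb c _]gbin_small ?mulr0 ?mul0r //; lia.
have {IHA IHm} [u ->] : exists u, B = (u + c)%N by exists (B - c)%N; rewrite subnK.
(* The factor 1 - q^u lets a single quotient cover u = 0 as well, where the binomial vanishes. *)
have h3 : gb (u + c + m) (m + c.+1)
    = qp (u + c + m) * (1 - q ^+ u) / (qp (m + c).+1 * qp u).
  case: u {le_cB} => [|u].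
    by rewrite gbin_small ?expr0 ?subrr ?mulr0 ?mul0r //; lia.
  have -> : (u.+1 + c + m = u + (m + c.+1))%N by lia.
  rewrite gbinD addnS [qp u.+1]qp_S.
  have := qp_neq0 (m + c).+1; have := qp_neq0 u; have := q1 u.
  by move=> h1 h2 h3; field; rewrite h1 h2 h3.
have hB k : gb (u + c + k) (k + c) = qp (u + c + k) / (qp (k + c) * qp u).
  by rewrite (_ : (u + c + k = u + (k + c))%N); [rewrite gbinD | lia].
have hA a k e : gb (a + k + e) k = qp (a + k + e) / (qp k * qp (a + e)).
  by rewrite (_ : (a + k + e = a + e + k)%N); [rewrite gbinD | lia].
rewrite h3 !hB !hA !(addnS, addSn) !qp_S.
have := qp_neq0 m; have := qp_neq0 u; have := qp_neq0 (m + c).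
have := qp_neq0 (A + c); have := q1 m; have := q1 (m + c)%N; have := q1 (A + c)%N.
rewrite !exprS !exprD => h4 h5 h6 h7 h8 h9 h10.
by field; rewrite h4 h5 h6 h7 h8 h9 h10.
Qed.

(** The q-Vandermonde sum, which is (q)_(A+B) times the limit of [saal] as m tends to infinity. *)
Definition vand A B c : K := \sum_(k < A.+1) q ^+ (k * (k + c)) * gb A k * gb B (k + c).

Lemma vandE A B c : vand A B c = gb (A + B) (A + c).
Proof.
elim: A c => [|A IH] c; first by rewrite /vand big_ord1 /= gbin0 mul0n expr0 !mul1r.
have -> : vand A.+1 B c = vand A B c + q ^+ (A.+1 + c) * vand A B c.+1.
  rewrite /vand [LHS]big_ord_recl /=.
  rewrite [X in _ = X + _](_ : _ = \sum_(k < A.+2) q ^+ (k * (k + c)) * gb A k * gb B (k + c)); last first.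
    by rewrite [RHS]big_ord_recr /= [gb A A.+1]gbin_small // mulr0 mul0r addr0.
  rewrite [X in _ = X + _]big_ord_recl /= !gbin0 -addrA; congr (_ + _).
  rewrite mulr_sumr sumrD; apply: eq_bigr => k _ /=.
  rewrite /bump /= !add1n gbinS.
  have le_kA : (k <= A)%N by rewrite -ltnS.
  rewrite mulrDr !mulrDl addnS; congr (_ + _); rewrite addSn !mulrA -!exprD.
  by congr (_ ^+ _ * _ * _); nia.
by rewrite !IH !addSn gbinS' addrC addnS.
Qed.
End Gauss.

(** * The Burge transform, the Bailey lemma and the seed identity *)

Lemma sum_ord_support (V : nmodType) (m n : nat) (f : nat -> V) :
  (forall k, (m <= k)%N -> f k = 0) -> (forall k, (n <= k)%N -> f k = 0) ->
  \sum_(k < m) f k = \sum_(k < n) f k.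
Proof.
wlog le_mn : m n / (m <= n)%N => [H hm hn|hm _].
  by have [/H->//|/ltnW/H<-//] := leqP m n.
rewrite [RHS](bigID (fun k : 'I_n => (k < m)%N)) /= [X in _ + X]big1 => [|k].
  by rewrite addr0 (big_ord_widen _ f le_mn).
by rewrite -leqNgt => /hm.
Qed.

Section Burge.
Variables (K : numFieldType) (q : K).
Hypothesis q1 : forall n, 1 - q ^+ n.+1 != 0.
Local Notation qp := (qpoch q q).
Local Notation gb := (gbin q).

(* The guard makes the factors vanish as they do for the integer binomial, in
   spite of the truncated subtractions. *)
Definition burge (L M a b : nat) : K :=
  if (a <= L)%N && (b <= M)%N
  then gb (L + a + (M - b)) (L + a) * gb (L - a + (M + b)) (L - a) else 0.

Lemma burgeC L M a b : burge L M a b = burge M L b a.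
Proof.
rewrite /burge andbC; case: ifP => // /andP[le_bM le_aL]; rewrite mulrC.
by congr (_ * _); (rewrite -gbin_sub; [congr (gbin _ _ _); lia|lia]).
Qed.

(** With L = a + b + l, the index i cancels from the upper entries of both binomials, which become
    2a + l and 2b + l, and only i = b + k with 0 <= k <= l lies in the support. This is the shape of
    [saal] and [vand] with shift c = 2b. *)
Lemma burge_sum_shift a b l (h : nat -> K) :
  \sum_(i < (a + b + l).+1) h i * burge (a + b + l - i) i a b
  = \sum_(k < l.+1) h (b + k)%N * (gb (a + a + l) k * gb (b + b + l) (k + (b + b))).
Proof.
rewrite -(big_mkord predT (fun i => h i * burge (a + b + l - i) i a b)).
rewrite (@big_cat_nat _ _ _ b) //=; last by lia.
rewrite big_nat_cond big1 ?add0r => [|i /andP[/andP[_ lt_ib] _]]; last first.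
  by rewrite /burge [(b <= i)%N]leqNgt lt_ib andbF mulr0.
rewrite -[X in \big[_/_]_(X <= _ < _) _]add0n big_addn big_mkord.
rewrite (_ : ((a + b + l).+1 - b = a + l.+1)%N); last by lia.
rewrite addnC big_split_ord /= [X in _ + X]big1 ?addr0 => [|i _]; last first.
  by have lt_ia := ltn_ord i; rewrite /burge (_ : (a <= _)%N = false) /= ?mulr0 //; lia.
apply: eq_bigr => k _; have le_kl : (k <= l)%N by rewrite -ltnS.
rewrite [(k + b)%N]addnC; congr (_ * _); rewrite /burge (_ : _ && _); last by lia.
congr (_ * _).
  rewrite (_ : (_ - _ + a + _ = a + a + l)%N); last by lia.
  by rewrite -[in RHS]gbin_sub; [congr (gbin _ _ _); lia|lia].
rewrite (_ : (_ - _ - _ + _ = b + b + l)%N); last by lia.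
by rewrite -[in RHS]gbin_sub; [congr (gbin _ _ _); lia|lia].
Qed.

Lemma burge_sum_small L a b (h : nat -> K) : (L < a + b)%N ->
  \sum_(i < L.+1) h i * burge (L - i) i a b = 0.
Proof.
move=> lt_L; rewrite big1 // => i _; rewrite /burge (_ : _ && _ = false) ?mulr0 //.
by have lt_iL := ltn_ord i; apply/negbTE; lia.
Qed.

(** This is [saalE] with A = 2a + l, B = 2b + l, c = 2b and m = M - b; the prefactor comes from (b +
    k)^2 = b^2 + k(k + 2b). *)
Lemma burge_transform L M a b :
  \sum_(i < L.+1) (if (i <= M)%N then q ^+ (i ^ 2) * gb (2 * L + (M - i)) (2 * L) else 0)
     * burge (L - i) i a b = q ^+ (b ^ 2) * burge L M (a + b) b.
Proof.
have [lt_L|le_abL] := ltnP L (a + b).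
  rewrite (burge_sum_small
    (fun i => if (i <= M)%N then q ^+ (i ^ 2) * gb (2 * L + (M - i)) (2 * L) else 0)) //.
  by rewrite /burge [(_ <= L)%N]leqNgt lt_L mulr0.
have [l ->] : exists l, L = (a + b + l)%N by exists (L - (a + b))%N; rewrite subnKC.
rewrite (burge_sum_shift a b l
    (fun i => if (i <= M)%N then q ^+ (i ^ 2) *
       gb (2 * (a + b + l) + (M - i)) (2 * (a + b + l)) else 0)).
have [lt_Mb|le_bM] := ltnP M b.
  rewrite /burge [(b <= M)%N]leqNgt lt_Mb andbF mulr0 big1 // => k _.
  by rewrite (_ : (b + k <= M)%N = false) ?mul0r //; apply/negbTE; lia.
have [m ->] : exists m, M = (b + m)%N by exists (M - b)%N; rewrite subnKC.
under eq_bigr => k _ do rewrite /= leq_add2l subnDl.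
rewrite (sum_ord_support (m := l.+1) (n := m.+1) (f := fun k =>
   (if (k <= m)%N then q ^+ ((b + k) ^ 2) * gb (2 * (a + b + l) + (m - k)) (2 * (a + b + l))
     else 0) * (gb (a + a + l) k * gb (b + b + l) (k + (b + b))))); first last.
- by move=> k; rewrite ltnNge => /negbTE ->; rewrite mul0r.
- by move=> k lt_lk; rewrite [gb (b + b + l) _]gbin_small ?mulr0 //; lia.
transitivity (q ^+ (b ^ 2) * saal q (a + a + l) (b + b + l) (b + b) m).
  rewrite /saal mulr_sumr; apply: eq_bigr => k _; rewrite -ltnS ltn_ord.
  rewrite (_ : ((b + k) ^ 2 = b ^ 2 + k * (k + (b + b)))%N) ?exprD; last by lia.
  rewrite (_ : (2 * (a + b + l) = a + a + l + (b + b + l))%N); last by lia.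
  by ring.
rewrite saalE //; congr (_ * _); rewrite /burge (_ : _ && _); last by lia.
congr (_ * _).
  by rewrite -[LHS]gbin_sub; [congr (gbin _ _ _); lia|lia].
by rewrite -[LHS]gbin_sub; [congr (gbin _ _ _); lia|lia].
Qed.

(** The limit M -> oo of [burge_transform], with [vandE] in place of [saalE]. It serves the first
    letter of a word. *)
Lemma burge_vandermonde L a b :
  \sum_(i < L.+1) q ^+ (i ^ 2) * burge (L - i) i a b
  = q ^+ (b ^ 2) * gb (2 * L) (L + (a + b)).
Proof.
have [lt_L|le_abL] := ltnP L (a + b).
  rewrite (burge_sum_small (fun i => q ^+ (i ^ 2))) //.
  by rewrite gbin_small ?mulr0 //; lia.
have [l ->] : exists l, L = (a + b + l)%N by exists (L - (a + b))%N; rewrite subnKC.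
rewrite (burge_sum_shift a b l (fun i => q ^+ (i ^ 2))).
rewrite (sum_ord_support (m := l.+1) (n := (a + a + l).+1) (f := fun k =>
   q ^+ ((b + k) ^ 2) * (gb (a + a + l) k * gb (b + b + l) (k + (b + b))))); first last.
- by move=> k lt_lk; rewrite [gb (a + a + l) _]gbin_small ?mul0r ?mulr0 //; lia.
- by move=> k lt_lk; rewrite [gb (b + b + l) _]gbin_small ?mulr0 //; lia.
transitivity (q ^+ (b ^ 2) * vand q (a + a + l) (b + b + l) (b + b)).
  rewrite /vand mulr_sumr; apply: eq_bigr => k _.
  rewrite (_ : ((b + k) ^ 2 = b ^ 2 + k * (k + (b + b)))%N) ?exprD; last by lia.
  by rewrite !mulrA.
by rewrite vandE //; congr (_ * gbin _ _ _); lia.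
Qed.

Definition invpair (L g : nat) : K :=
  if (g <= L)%N then (qp (L - g) * qp (L + g))^-1 else 0.

(* By Pascal's rule the sum for (n+1, c) equals the sum for (n, c+1). *)
Lemma sum_gbin_qpoch n c :
  \sum_(k < n.+1) q ^+ (k * (k + c)) * gb n k / qp (c + k) = (qp (n + c))^-1.
Proof.
elim: n c => [|n IH] c; first by rewrite big_ord1 /= mul0n expr0 gbin0 // !mul1r addn0.
rewrite addSnnS -IH big_ord_recl /= gbin0 // mul0n expr0 !mul1r addn0.
have E : \sum_(i < n.+1) q ^+ (bump 0 i * (bump 0 i + c)) * gb n.+1 (bump 0 i) / qp (c + bump 0 i) =
  \sum_(i < n.+1) q ^+ (i.+1 * (i.+1 + c) + i.+1) * gb n i.+1 / qp (c + i.+1)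
  + \sum_(i < n.+1) q ^+ (i.+1 * (i.+1 + c)) * gb n i / qp (c + i.+1).
  rewrite sumrD; apply: eq_bigr => i _; rewrite /bump /= add1n gbinS' // exprD.
  by ring.
rewrite E {E} addrA.
have -> : (qp c)^-1 + \sum_(i < n.+1) q ^+ (i.+1 * (i.+1 + c) + i.+1) * gb n i.+1 / qp (c + i.+1)
   = \sum_(i < n.+1) q ^+ (i * (i + c) + i) * gb n i / qp (c + i).
  rewrite [LHS](_ : _ = \sum_(i < n.+2) q ^+ (i * (i + c) + i) * gb n i / qp (c + i)).
    by rewrite big_ord_recr /= (@gbin_small _ _ n) // mulr0 mul0r addr0.
  by rewrite [RHS]big_ord_recl /= gbin0 // mul0n expr0 !mul1r addn0.
rewrite sumrD; apply: eq_bigr => i _.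
rewrite !addnS addSn qp_S.
have := qp_neq0 q1 (c + i); have := q1 (c + i)%N.
rewrite (_ : (i * (i + c) + i = i * (i + c).+1)%N); last by lia.
rewrite (_ : (i.+1 * (i + c).+1 = i * (i + c).+1 + (c + i).+1)%N) ?exprD; last by lia.
by move=> h1 h2; field; rewrite h1 h2.
Qed.

(** The Bailey lemma relative to 1, with both free parameters sent to infinity, on a single term.
    With m = g + k and L = g + l it is [sum_gbin_qpoch] for n = l and c = 2g. *)
Lemma bailey L g :
  \sum_(m < L.+1) q ^+ (m ^ 2) / qp (L - m) * invpair m g
  = q ^+ (g ^ 2) * invpair L g.
Proof.
have [lt_Lg|le_gL] := ltnP L g.
  rewrite {2}/invpair [(g <= L)%N]leqNgt lt_Lg mulr0 big1 // => m _.
  by have lt_mL := ltn_ord m; rewrite /invpair (_ : (g <= m)%N = false) ?mulr0 //; apply/negbTE; lia.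
have [l ->] : exists l, L = (g + l)%N by exists (L - g)%N; rewrite subnKC.
rewrite -addnS big_split_ord /= big1 ?add0r => [|i _]; last first.
  by rewrite /invpair (_ : (g <= i)%N = false) ?mulr0 //; apply/negbTE; rewrite -ltnNge.
rewrite /invpair leq_addr addKn (_ : (g + l + g = l + (g + g))%N); last by lia.
rewrite invfM -sum_gbin_qpoch !mulr_sumr; apply: eq_bigr => k _.
have le_kl : (k <= l)%N by rewrite -ltnS.
rewrite leq_addr addKn subnDl (_ : (g + k + g = g + g + k)%N); last by lia.
rewrite (_ : ((g + k) ^ 2 = g ^ 2 + k * (k + (g + g)))%N) ?exprD; last by lia.
rewrite /gbin le_kl.
have := qp_neq0 q1 (g + g + k); have := qp_neq0 q1 (l - k).
have := qp_neq0 q1 l; have := qp_neq0 q1 k => h1 h2 h3 h4.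
by field; rewrite h1 h2 h3 h4.
Qed.

(** The finite q-binomial theorem; the parameter s = 1 or -1 treats (-X;q)_n and (X;q)_n at once. *)
Lemma coef_prod_one_plus (s : K) n k :
  (\prod_(i < n) (1 + (s * q ^+ i) *: 'X : {poly K}))`_k
  = s ^+ k * q ^+ 'C(k, 2) * gb n k.
Proof.
elim: n k => [|n IH] k.
  rewrite big_ord0 coef1; case: k => [|k]; first by rewrite gbin0 // !mulr1.
  by rewrite gbin_small // mulr0.
rewrite big_ord_recr /= mulrDr mulr1 coefD -scalerAr coefZ coefMX IH.
case: k => [|k]; first by rewrite /= mulr0 addr0 !gbin0.
rewrite /= IH gbinS // binS bin1 exprD exprS.
have [le_kn|lt_nk] := leqP k n; last first.
  by rewrite !(gbin_small q lt_nk) (gbin_small q (ltnW lt_nk : (n < k.+1)%N)); ring.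
have -> : q ^+ n = q ^+ k * q ^+ (n - k) by rewrite -exprD subnKC.
by ring.
Qed.

Lemma sum_centered (L : nat) (f : nat -> K) :
  \sum_(i < (2 * L).+1) f i
  = f L + \sum_(j < L) (f (L - j.+1)%N + f (L + j.+1)%N).
Proof.
rewrite (_ : (2 * L).+1 = (L + L.+1)%N); last by lia.
rewrite big_split_ord /= big_ord_recl /= addn0 addrCA; congr (_ + _).
rewrite -sumrD; congr (_ + _); rewrite (reindex_inj rev_ord_inj) /=.
by apply: eq_bigr.
Qed.

(* B(L,M,-a,-b) = B(L,M,a,b), so the terms j and -j of the bilateral sums are
   merged. *)
Definition signed_theta_coef (j : nat) : K := if j is 0 then 1 else 2 * (-1) ^+ j.
Local Notation sc := signed_theta_coef.

Lemma coef_prod_one_minus_sqr (y : K) n k : (forall n, 1 - y ^+ n.+1 != 0) ->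
  (\prod_(i < n) (1 - y ^+ i *: 'X^2 : {poly K}))`_(2 * k)
  = (-1) ^+ k * y ^+ 'C(k, 2) * gbin y n k.
Proof.
move=> y1; elim: n k => [|n IH] k.
  rewrite big_ord0 coef1; case: k => [|k]; first by rewrite gbin0 // !mulr1.
  by rewrite gbin_small // mulr0.
rewrite big_ord_recr /= mulrBr mulr1 coefB -scalerAr coefZ coefMXn IH.
case: k => [|k]; first by rewrite /= mulr0 subr0 !gbin0.
rewrite mulnS ltnNge leq_addr addKn /= IH gbinS // binS bin1 exprD exprS.
have [le_kn|lt_nk] := leqP k n; last first.
  by rewrite !(gbin_small y lt_nk) (gbin_small y (ltnW lt_nk : (n < k.+1)%N)); ring.
have -> : y ^+ n = y ^+ k * y ^+ (n - k) by rewrite -exprD subnKC.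
by ring.
Qed.

Lemma burge_diag L M j : (j <= L)%N ->
  burge L M j j = gb (L + M) (L - j) * gb (L + M) (L + j).
Proof.
move=> le_jL; rewrite /burge le_jL /=; have [le_jM|lt_Mj] := leqP j M.
  by rewrite mulrC; congr (gbin _ _ _ * gbin _ _ _); lia.
by rewrite [gb _ (L + j)]gbin_small ?mulr0 //; lia.
Qed.

Lemma sqr_not1 n : 1 - (q ^+ 2) ^+ n.+1 != 0.
Proof. by rewrite -exprM mulnS; exact: (q1 (2 * n).+1). Qed.

(* Compare the coefficients of X^(2L) in (X;q)_n (-X;q)_n = (X^2;q^2)_n, n = L+M. *)
Lemma signed_burge_diag_sum L M :
  \sum_(j < L.+1) sc j * q ^+ (j ^ 2) * burge L M j j = gbin (q ^+ 2) (L + M) L.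
Proof.
rewrite big_ord_recl /= mul1r mul1r burge_diag // subn0 addn0.
under eq_bigr => j _ do rewrite burge_diag ?ltn_ord //.
(* At q = 0 the common factor [u] divided out below may vanish, so this case is computed
   directly. *)
have [q0|q_neq0] := eqVneq q 0.
  have gb1 n k : (k <= n)%N -> gbin (0 : K) n k = 1.
    move=> le_kn; rewrite /gbin le_kn.
    have E m : qpoch 0 0 m = 1 :> K.
      by elim: m => [|m IHm]; rewrite ?qpoch0 // qpochS IHm mul0r subr0 mulr1.
    by rewrite !E mulr1 divr1.
  rewrite q0 expr0n /= !gb1 ?leq_addr // mulr1 big1 ?addr0 // => j _.
  by rewrite expr0n /= mulr0 mul0r.
pose p (s : K) : {poly K} := \prod_(i < L + M) (1 + (s * q ^+ i) *: 'X).
have Epr : p 1 * p (-1) = \prod_(i < L + M) (1 - (q ^+ 2) ^+ i *: 'X^2).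
  rewrite /p -big_split; apply: eq_bigr => i _ /=.
  rewrite mul1r mulN1r scaleNr -exprM mulnC exprM.
  rewrite mulrC -subr_sqr expr1n; congr (1 - _).
  by rewrite exprZn.
have := congr1 (fun r : {poly K} => r`_(2 * L)) Epr.
rewrite coef_prod_one_minus_sqr; last exact: sqr_not1.
rewrite coefM (sum_centered L (fun i => (p 1)`_i * (p (-1))`_(2 * L - i))).
have L0 : (2 * L - L = L)%N by lia.
rewrite L0 !coef_prod_one_plus expr1n mul1r => E.
(* The coefficients at L - j and L + j multiply to (-1)^(L+j) q^(C(L-j,2) + C(L+j,2)) times
   binomials, and this exponent is L(L-1) + j^2; [u] is the part free of j. *)
pose u := (-1) ^+ L * q ^+ ('C(L, 2) + 'C(L, 2)) : K.
have u_neq0 : u != 0 by rewrite mulf_neq0 ?expf_neq0 // oppr_eq0 oner_eq0.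
apply: (mulfI u_neq0); transitivity ((-1) ^+ L * (q ^+ 2) ^+ 'C(L, 2) * gbin (q ^+ 2) (L + M) L); last first.
  by rewrite /u -exprM mul2n addnn.
rewrite -E mulrDr; congr (_ + _); first by rewrite /u exprD; ring.
rewrite mulr_sumr; apply: eq_bigr => j _; rewrite /bump /= add1n.
have lt_jL := ltn_ord j.
rewrite (_ : (2 * L - (L - j.+1) = L + j.+1)%N); last by lia.
rewrite (_ : (2 * L - (L + j.+1) = L - j.+1)%N); last by lia.
rewrite !coef_prod_one_plus !expr1n !mul1r.
have EC : ('C(L, 2) + 'C(L, 2) + j.+1 ^ 2 = 'C(L - j.+1, 2) + 'C(L + j.+1, 2))%N.
  have E2 k : ('C(k, 2) * 2 = k * k.-1)%N 
    by elim: k => // k IHk; rewrite binS bin1; nia.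
  move: (nat_of_ord j) lt_jL => i lt_iL.
  have := E2 L; have := E2 (L - i.+1)%N; have := E2 (L + i.+1)%N.
  have [k ->] : exists k, L = (k + i.+1)%N by exists (L - i.+1)%N; rewrite subnK.
  rewrite addnK -mulnn (addnS k i) (addnS (k + i).+1 i) !succnK.
  by case: k => [|k]; rewrite ?succnK ?add0n ?mul0n ?addSn; lia.
have Es : (-1) ^+ (L + j.+1) = (-1) ^+ L * (-1) ^+ j.+1 :> K by rewrite exprD.
have Es' : (-1) ^+ (L - j.+1) = (-1) ^+ L * (-1) ^+ j.+1 :> K.
  by rewrite -signr_odd oddB // signr_addb !signr_odd.
transitivity ((-1) ^+ L * (2 * (-1) ^+ j.+1) * q ^+ ('C(L, 2) + 'C(L, 2) + j.+1 ^ 2) *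
   (gb (L + M) (L - j.+1) * gb (L + M) (L + j.+1))).
  by rewrite /u [in RHS]exprD; ring.
rewrite EC exprD Es Es'; move: ((-1) ^+ L) ((-1) ^+ j.+1) => s t.
by ring.
Qed.

End Burge.

(** * Fermionic sums along a continued fraction *)

(** An iterated form of the box sum with the first variable outermost, so that the variables
    attached to the end of the continued fraction are summed first. *)
Fixpoint nested_sum (V : nmodType) (d N : nat) (F : seq nat -> V) : V :=
  if d is d'.+1 then \sum_(x < N) nested_sum d' N (fun s => F (val x :: s)) else F [::].

Lemma eq_nested_sum (V : nmodType) d N (F G : seq nat -> V) :
  (forall s, size s = d -> F s = G s) -> nested_sum d N F = nested_sum d N G.
Proof.
elim: d F G => [|d IH] F G FG /=; first exact: FG.
by apply: eq_bigr => x _; apply: IH => s ss; apply: FG; rewrite /= ss.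
Qed.

Lemma nested_sumZ (R : pzSemiRingType) d N (c : R) (F : seq nat -> R) :
  nested_sum d N (fun s => c * F s) = c * nested_sum d N F.
Proof.
elim: d F => [|d IH] F //=; rewrite mulr_sumr.
by apply: eq_bigr => x _; rewrite IH.
Qed.

(* A word lists the truth values of "j is some t_i", from the first index to the
   last; the innermost (last) letters act first. Its slope (a, b) is the pair
   reached from the seed (1, 1). *)
Definition slope_step (t : bool) (p : nat * nat) : nat * nat :=
  if t then (p.1 + p.2, p.1)%N else (p.1 + p.2, p.2)%N.
Definition slope (w : seq bool) : nat * nat := foldr slope_step (1, 1)%N w.

Lemma slope_gt0 w : (0 < (slope w).1)%N && (0 < (slope w).2)%N.
Proof. by elim: w => // -[] w /=; lia. Qed.

Section Fermionic.
Variables (K : numFieldType) (q : K).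
Hypothesis q1 : forall n, 1 - q ^+ n.+1 != 0.
Local Notation qp := (qpoch q q).
Local Notation gb := (gbin q).
Local Notation sc := (@signed_theta_coef K).

(** The square i^2 of the Burge transform for i = z or i = y - z. The absolute value prevents
    truncation when z > y, so that the link with the quadratic form holds for all arguments. *)
Definition step_exp (t : bool) (y z : nat) : nat :=
  if t then (z ^ 2)%N else (`|y%:Z - z%:Z| ^ 2)%N.
Definition step_n (t : bool) (x y z : nat) : int :=
  if t then x%:Z - y%:Z - z%:Z else x%:Z - (2 * y)%N%:Z + z%:Z.

(* With x, y, z standing for m_(j-1), m_j, m_(j+1), the pair (L, M) of the Burge
   transform is (y, x - y), and the summation variable is i = y - z, or i = z
   after the swap (t = true). *)
Fixpoint chain (w : seq bool) (x y : nat) (s : seq nat) : K :=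
  match w, s with
  | [::], _ => qbinom (q ^+ 2) (y%:Z + (x%:Z - y%:Z)) y%:Z
  | t :: w', z :: s' =>
      q ^+ step_exp t y z * qbinom q ((2 * y)%N%:Z + step_n t x y z) (2 * y)%N%:Z
      * chain w' y z s'
  | _ :: _, [::] => 0
  end.

(** The alternating sum of Burge products for L = y and M = x - y. The guard stands for a negative
    M, which natural subtraction would turn into 0. *)
Definition bosonic (a b x y : nat) : K :=
  if (y <= x)%N then
    \sum_(j < y.+1) sc j * q ^+ (a * b * j ^ 2) * burge q y (x - y) (a * j) (b * j)
  else 0.

Lemma bosonicE a b x y n : (0 < a)%N -> (y <= x)%N -> (y < n)%N ->
  bosonic a b x y
  = \sum_(j < n) sc j * q ^+ (a * b * j ^ 2) * burge q y (x - y) (a * j) (b * j).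
Proof.
move=> a_gt0 le_yx lt_yn; rewrite /bosonic le_yx.
pose f j := sc j * q ^+ (a * b * j ^ 2) * burge q y (x - y) (a * j) (b * j).
have f0 k : (y < k)%N -> f k = 0.
  by move=> lt_yk; rewrite /f /burge (_ : _ && _ = false) ?mulr0 //; apply/negbTE; nia.
apply: (sum_ord_support (f := f)) => k hk; apply: f0; lia.
Qed.

Lemma qbinom_addl y (n : int) : qbinom q (y%:Z + n) y%:Z =
  if (0 <= n) then gb (y + `|n|) y else 0.
Proof.
case: ifP => [n_ge0|n_lt0]; last by rewrite /qbinom lerDl n_lt0 andbF.
by rewrite -{1}(gez0_abs n_ge0) -PoszD qbinomE.
Qed.

Lemma bosonic_sum_exchange a b y (h : nat -> K) : (0 < a)%N ->
  \sum_(z < y.+1) h z * bosonic a b y z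
  = \sum_(j < y.+1) sc j * q ^+ (a * b * j ^ 2) *
      \sum_(z < y.+1) h z * burge q z (y - z) (a * j) (b * j).
Proof.
move=> a_gt0.
under eq_bigr => z _ do rewrite (bosonicE b a_gt0 (leq_ord z) (ltn_ord z)) mulr_sumr.
rewrite exchange_big; apply: eq_bigr => j _; rewrite mulr_sumr.
by apply: eq_bigr => z _; ring.
Qed.

(** Termwise in j, [burge_transform] contributes q^((bj)^2), and abj^2 becomes (a+b)bj^2. For t =
    true, [burgeC] first exchanges aj and bj, so the new exponent is (a+b)aj^2. *)
Lemma bosonic_step t p x y : (0 < p.1)%N -> (0 < p.2)%N -> (y <= x)%N ->
  \sum_(z < y.+1) q ^+ step_exp t y z
     * qbinom q ((2 * y)%N%:Z + step_n t x y z) (2 * y)%N%:Z * bosonic p.1 p.2 y z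
  = bosonic (slope_step t p).1 (slope_step t p).2 x y.
Proof.
case: p => a b /= a_gt0 b_gt0 le_yx.
rewrite (bosonic_sum_exchange b y (fun z => q ^+ step_exp t y z
     * qbinom q ((2 * y)%N%:Z + step_n t x y z) (2 * y)%N%:Z)) //.
rewrite /bosonic le_yx; apply: eq_bigr => j _.
have hq i : qbinom q ((2 * y)%N%:Z + ((x - y)%N%:Z - i%:Z)) (2 * y)%N%:Z
   = if (i <= x - y)%N then gb (2 * y + (x - y - i)) (2 * y) else 0.
  rewrite qbinom_addl subr_ge0 lez_nat; case: ifP => // le_i.
  by rewrite subzn.
case: t => /=.
  under eq_bigr => z _ do rewrite (subzn le_yx) hq burgeC.
  transitivity (sc j * q ^+ (a * b * j ^ 2) * (q ^+ ((a * j) ^ 2) * burge q y (x - y) (b * j + a * j) (a * j))).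
    congr (_ * _); rewrite -burge_transform //; apply: eq_bigr => z _.
    by case: ifP => _; rewrite ?mulr0.
  rewrite (_ : (b * j + a * j = (a + b) * j)%N); last by lia.
  rewrite (_ : ((a + b) * a * j ^ 2 = a * b * j ^ 2 + (a * j) ^ 2)%N) ?exprD; last by lia.
  by rewrite !mulrA.
rewrite (reindex_inj rev_ord_inj) /=.
transitivity (sc j * q ^+ (a * b * j ^ 2) * (q ^+ ((b * j) ^ 2) * burge q y (x - y) (a * j + b * j) (b * j))).
  congr (_ * _); rewrite -burge_transform //; apply: eq_bigr => z _; rewrite subSS.
  have le_zy : (z <= y)%N by rewrite -ltnS.
  rewrite (_ : (y - (y - z) = z)%N); last by lia.
  rewrite (_ : `|y%:Z - (y - z)%N%:Z|%N = z); last by lia.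
  rewrite (_ : x%:Z - _ + _ = (x - y)%N%:Z - z%:Z); last by lia.
  by rewrite hq; case: ifP => _; rewrite ?mulr0 // -mulrA.
rewrite (_ : (a * j + b * j = (a + b) * j)%N); last by lia.
rewrite (_ : ((a + b) * b * j ^ 2 = a * b * j ^ 2 + (b * j) ^ 2)%N) ?exprD; last by lia.
by rewrite !mulrA.
Qed.

Lemma chain_sum w N x y : (y < N)%N ->
  nested_sum (size w) N (chain w x y) = bosonic (slope w).1 (slope w).2 x y.
Proof.
elim: w x y => [|t w IH] x y lt_yN /=.
  rewrite addrCA subrr addr0 qbinomE /bosonic; case: leqP => [le_yx|]; last exact: gbin_small.
  rewrite -{1}(subnKC le_yx) -signed_burge_diag_sum //.
  by apply: eq_bigr => j _; rewrite !mul1n.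
have /andP[s1 s2] := slope_gt0 w.
under eq_bigr => z _ do rewrite nested_sumZ IH //.
(* For x < y the right side is 0 by the guard; on the left, z > y kills the inner closed form, and z
   <= y makes [step_n] negative, hence the binomial 0. *)
have [le_yx|lt_xy] := leqP y x; last first.
  rewrite [RHS]/bosonic [(y <= x)%N]leqNgt lt_xy big1 // => z _.
  have [le_zy|lt_yz] := leqP z y; last by rewrite /bosonic [(z <= y)%N]leqNgt lt_yz mulr0.
  rewrite qbinom_addl (_ : (0 <= _) = false) ?mulr0 ?mul0r //; apply/negbTE.
  by rewrite -ltNge /step_n; case: t; lia.
rewrite -(bosonic_step t s1 s2 le_yx).
apply: (sum_ord_support (f := fun z => q ^+ step_exp t y z
     * qbinom q ((2 * y)%N%:Z + step_n t x y z) (2 * y)%N%:Z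
     * bosonic (slope w).1 (slope w).2 y z)) => z hz; rewrite /bosonic (_ : (z <= y)%N = false) ?mulr0 //;
  apply/negbTE; lia.
Qed.

(** The beta side of a Bailey pair relative to 1 whose alpha side lives on the multiples of g, with
    value [sc j * q ^+ (e * j ^ 2)] at gj. *)
Definition bailey_beta (g e L : nat) : K :=
  \sum_(j < L.+1) sc j * q ^+ (e * j ^ 2) * invpair q L (g * j).

Lemma bailey_betaE g e L n : (0 < g)%N -> (L < n)%N ->
  bailey_beta g e L = \sum_(j < n) sc j * q ^+ (e * j ^ 2) * invpair q L (g * j).
Proof.
move=> g_gt0 lt_Ln.
apply: (sum_ord_support (f := fun j => sc j * q ^+ (e * j ^ 2) * invpair q L (g * j))) => k hk;
  rewrite /invpair (_ : (_ <= L)%N = false) ?mulr0 //; apply/negbTE; nia.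
Qed.

(** By [bailey] the term at gj only gains the factor q^((gj)^2): the pair keeps its shape and e
    grows by g^2. *)
Lemma bailey_step g e L : (0 < g)%N ->
  \sum_(m < L.+1) q ^+ (m ^ 2) / qp (L - m) * bailey_beta g e m
  = bailey_beta g (e + g ^ 2) L.
Proof.
move=> g_gt0.
under eq_bigr => m _ do rewrite (bailey_betaE e g_gt0 (ltn_ord m)) mulr_sumr.
rewrite exchange_big; apply: eq_bigr => j _.
rewrite (_ : ((e + g ^ 2) * j ^ 2 = e * j ^ 2 + (g * j) ^ 2)%N) ?exprD; last by lia.
rewrite -!mulrA -bailey // !mulr_sumr.
by apply: eq_bigr => m _; ring.
Qed.

(** What becomes of [chain] as x tends to infinity: the first binomial, whose upper entry grows with
    x, turns into the reciprocal of a q-factorial. *)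
Definition top_chain (w : seq bool) (y : nat) (s : seq nat) : K :=
  match w, s with
  | [::], _ => (qpoch (q ^+ 2) (q ^+ 2) y)^-1
  | t :: w', z :: s' => q ^+ step_exp t y z / qp (2 * y) * chain w' y z s'
  | _ :: _, [::] => 0
  end.

(** The letters after the first are summed by [chain_sum], and the first one by [burge_vandermonde].
    The empty word is a limit of the seed and is settled by [signed_invpair_sum]. *)
Lemma top_chain_sum w N y : (y < N)%N -> w != [::] ->
  nested_sum (size w) N (top_chain w y)
  = bailey_beta (slope w).1 ((slope w).1 * (slope w).2) y.
Proof.
case: w => // t w lt_yN _ /=.
have /andP[s1 s2] := slope_gt0 w.
under eq_bigr => z _ do rewrite nested_sumZ chain_sum //.
rewrite (sum_ord_support (n := y.+1) (f := fun z => q ^+ step_exp t y z / qp (2 * y)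
     * bosonic (slope w).1 (slope w).2 y z)); first last.
- by move=> z lt_yz; rewrite /bosonic [(z <= y)%N]leqNgt lt_yz mulr0.
- by move=> z lt_Nz; rewrite /bosonic (_ : (z <= y)%N = false) ?mulr0 //; apply/negbTE; lia.
case: (slope w) s1 s2 => a b /= a_gt0 b_gt0.
rewrite (bosonic_sum_exchange b y (fun z => q ^+ step_exp t y z / qp (2 * y))) //.
apply: eq_bigr => j _.
have inv g : gb (2 * y) (y + g) / qp (2 * y) = invpair q y g.
  rewrite /gbin /invpair (_ : (y + g <= 2 * y)%N = (g <= y)%N); last by lia.
  case: ifP => le_gy; last by rewrite mul0r.
  rewrite (_ : (2 * y - (y + g) = y - g)%N); last by lia.
  have := qp_neq0 q1 (2 * y); have := qp_neq0 q1 (y - g); have := qp_neq0 q1 (y + g).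
  by move=> h1 h2 h3; field; rewrite h1 h2 h3.
have vdm c d : \sum_(i < y.+1) q ^+ (i ^ 2) / qp (2 * y) * burge q (y - i) i c d
    = q ^+ (d ^ 2) * invpair q y (c + d).
  rewrite -inv mulrA -burge_vandermonde // mulr_suml.
  by apply: eq_bigr => i _; rewrite mulrAC.
case: t => /=.
  under eq_bigr => z _ do rewrite burgeC -{2}(subKn (leq_ord z)).
  transitivity (sc j * q ^+ (a * b * j ^ 2) * (q ^+ ((a * j) ^ 2) * invpair q y (b * j + a * j))).
    congr (_ * _); rewrite -vdm; apply: eq_bigr => z _.
    by rewrite (_ : (y - (y - z) = z)%N) //; have := leq_ord z; lia.
  rewrite (_ : (b * j + a * j = (a + b) * j)%N); last by lia.
  rewrite (_ : ((a + b) * a * j ^ 2 = a * b * j ^ 2 + (a * j) ^ 2)%N) ?exprD; last by lia.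
  by rewrite !mulrA.
rewrite (reindex_inj rev_ord_inj) /=.
transitivity (sc j * q ^+ (a * b * j ^ 2) * (q ^+ ((b * j) ^ 2) * invpair q y (a * j + b * j))).
  congr (_ * _); rewrite -vdm; apply: eq_bigr => z _; rewrite subSS.
  have le_zy : (z <= y)%N by rewrite -ltnS.
  rewrite (_ : (y - (y - z) = z)%N); last by lia.
  by rewrite (_ : `|y%:Z - (y - z)%N%:Z|%N = z); last by lia.
rewrite (_ : (a * j + b * j = (a + b) * j)%N); last by lia.
rewrite (_ : ((a + b) * b * j ^ 2 = a * b * j ^ 2 + (b * j) ^ 2)%N) ?exprD; last by lia.
by rewrite !mulrA.
Qed.

End Fermionic.

(** * Convergence in the complex numbers *)

Section ComplexLimits.
Variable R : realType.
Local Notation C := (Cpx R).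
Local Notation toC := (@real_complex_def R (Phant R)).

Lemma norm_real_complex (x : R) : `|toC x : C| = toC `|x|.
Proof. by rewrite normc_def /= expr0n /= addr0 sqrtr_sqr. Qed.

Lemma complex_norm_le (z : C) : `|z| <= toC (`|complex.Re z| + `|complex.Im z|).
Proof.
rewrite {1}[z]complexE (le_trans (ler_normD _ _)) // normrM.
have -> : `|'i%C : C| = 1 by rewrite normc_def /= expr0n /= add0r expr1n sqrtr1.
by rewrite mul1r !norm_real_complex -raddfD.
Qed.

Lemma complex_norm_Re (z : C) : toC `|complex.Re z| <= `|z|.
Proof. exact: normc_ge_Re. Qed.

Lemma complex_norm_Im (z : C) : toC `|complex.Im z| <= `|z|.
Proof.
rewrite normc_def lecR -sqrtr_sqr ler_sqrt ?addr_ge0 ?sqr_ge0 //.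
by rewrite lerDr sqr_ge0.
Qed.

Lemma complex_ReB (z w : C) : complex.Re (z - w) = complex.Re z - complex.Re w.
Proof. by case: z w => [a b] [c d]. Qed.

Lemma complex_ImB (z w : C) : complex.Im (z - w) = complex.Im z - complex.Im w.
Proof. by case: z w => [a b] [c d]. Qed.

Lemma cvg_complex (u : nat -> C) (a b : R) :
  (fun n => complex.Re (u n)) @ \oo --> a -> (fun n => complex.Im (u n)) @ \oo --> b ->
  u @ \oo --> (Complex a b : C).
Proof.
move=> /cvgrPdist_lt ua /cvgrPdist_lt ub; apply/cvgrPdist_lt => e e_gt0.
have /complex_realP[x Ee] := gtr0_real e_gt0.
have x_gt0 : 0 < x by move: e_gt0; rewrite Ee ltcR.
have x2_gt0 : 0 < x / 2 by rewrite divr_gt0.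
near=> n; apply: le_lt_trans (complex_norm_le _) _.
rewrite complex_ReB complex_ImB /= Ee ltcR [x]splitr; apply: ltrD.
  by near: n; exact: ua.
by near: n; exact: ub.
Unshelve. all: by end_near. Qed.

Lemma is_cvg_geometric_steps (w : nat -> R) (D r : R) : 0 <= r -> r < 1 ->
  (forall n, `|w n.+1 - w n| <= D * r ^+ n) -> cvgn w.
Proof.
move=> r_ge0 r_lt1 hw.
have h : cvgn (series (fun n => w n.+1 - w n)).
  apply: normed_cvg; apply: (@series_le_cvg _ _ (geometric D r)).
  - by move=> n; exact: normr_ge0.
  - by move=> n; exact: le_trans (normr_ge0 _) (hw n).
  - exact: hw.
  - by apply: is_cvg_geometric_series; rewrite ger0_norm.
have -> : w = (fun n => w 0%N + series (fun n => w n.+1 - w n) n).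
  by apply/funext => n; rewrite seriesEnat /= telescope_sumr // addrC subrK.
by apply: is_cvgD => //; exact: is_cvg_cst.
Qed.

(** In the order on the complex numbers, 0 <= r forces r to be real, and likewise for D; the real
    and imaginary parts then obey the same bound over the reals. *)
Lemma is_cvg_complex_geometric_steps (u : nat -> C) (D r : C) : 0 <= r -> r < 1 ->
  (forall n, `|u n.+1 - u n| <= D * r ^+ n) -> cvgn u.
Proof.
move=> r_ge0 r_lt1 hu.
have /complex_realP[x Er] := ger0_real r_ge0.
have D_ge0 : 0 <= D by have := hu 0%N; rewrite expr0 mulr1; apply: le_trans.
have /complex_realP[d Ed] := ger0_real D_ge0.
have x_ge0 : 0 <= x by move: r_ge0; rewrite Er lecR.
have x_lt1 : x < 1 by move: r_lt1; rewrite Er ltcR.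
have hD n : D * r ^+ n = toC (d * x ^+ n) by rewrite Er Ed rmorphM rmorphXn.
have hre : cvgn (fun n => complex.Re (u n)).
  apply: (is_cvg_geometric_steps (D := d) x_ge0 x_lt1) => n.
  by have := le_trans (complex_norm_Re _) (hu n); rewrite hD lecR complex_ReB.
have him : cvgn (fun n => complex.Im (u n)).
  apply: (is_cvg_geometric_steps (D := d) x_ge0 x_lt1) => n.
  by have := le_trans (complex_norm_Im _) (hu n); rewrite hD lecR complex_ImB.
move/cvg_ex: hre => [a ha]; move/cvg_ex: him => [b hb].
by apply/cvg_ex; exists (Complex a b); exact: cvg_complex.
Qed.

Lemma cvg_complex_expr (r : C) : 0 <= r -> r < 1 -> (fun n => r ^+ n) @ \oo --> (0 : C).
Proof.
move=> r_ge0 r_lt1.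
have /complex_realP[x Er] := ger0_real r_ge0.
have x_ge0 : 0 <= x by move: r_ge0; rewrite Er lecR.
have x_lt1 : x < 1 by move: r_lt1; rewrite Er ltcR.
have E n : r ^+ n = toC (x ^+ n) by rewrite Er rmorphXn.
apply: (cvg_complex (a := 0) (b := 0)).
  under eq_fun => n do rewrite E /=.
  by apply: cvg_expr; rewrite ger0_norm.
under eq_fun => n do rewrite E /=.
exact: cvg_cst.
Qed.

Lemma geometric_sum_le (r : C) n : 0 <= r -> r < 1 ->
  \sum_(i < n) r ^+ i <= (1 - r)^-1.
Proof.
move=> r_ge0 r_lt1; rewrite -[_^-1]mul1r ler_pdivlMr ?subr_gt0 //.
rewrite mulrC -opprB mulNr -subrX1 opprB lerBlDr lerDl exprn_ge0 //.
Qed.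

Lemma geometric_tail_le (f : nat -> C) (D r : C) m n : 0 <= r -> r < 1 ->
  (forall k, `|f k| <= D * r ^+ k) ->
  `|\sum_(m <= k < n) f k| <= D / (1 - r) * r ^+ m.
Proof.
move=> r_ge0 r_lt1 hf.
have D_ge0 : 0 <= D by have := hf 0%N; rewrite expr0 mulr1; apply: le_trans.
apply: le_trans (ler_norm_sum _ _ _) _.
apply: le_trans (ler_sum _ (fun k _ => hf k)) _.
rewrite -[m]add0n big_addn big_mkord.
under eq_bigr => k _ do rewrite exprD mulrA.
rewrite -mulr_suml -mulr_sumr add0n ler_wpM2r ?exprn_ge0 // ler_wpM2l //.
exact: geometric_sum_le.
Qed.

Lemma cvg_finite_sum (u : nat -> nat -> C) (v : nat -> C) n :
  (forall k, (u^~ k) @ \oo --> v k) ->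
  (fun i => \sum_(k < n) u i k) @ \oo --> \sum_(k < n) v k.
Proof.
move=> uv; elim: n => [|n IH].
  by under eq_fun => i do rewrite big_ord0; rewrite big_ord0; exact: cvg_cst.
under eq_fun => i do rewrite big_ord_recr /=.
rewrite big_ord_recr /=.
exact: (cvgD (f := fun i => \sum_(k < n) u i k) (g := fun i => u i n) IH (uv n)).
Qed.

Lemma cvg_norm_le (u : nat -> C) (l D : C) :
  u @ \oo --> l -> (\forall n \near \oo, `|u n| <= D) -> `|l| <= D.
Proof.
move=> /cvgrPdist_lt ul uD; apply/ler_addgt0Pr => e e_gt0.
near \oo => n; rewrite -(subrK (u n) l) addrC; apply: le_trans (ler_normD _ _) _.
rewrite addrC [D + e]addrC; apply: lerD; last by near: n.
by apply: ltW; near: n; exact: ul.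
Unshelve. all: by end_near. Qed.

(** The tails past m of both sums are at most D r^m / (1 - r), uniformly in n, and the first m terms
    converge; an e/3 argument concludes. Both limits are returned as one s, so that either can be
    evaluated through the other. *)
Lemma tannery (u : nat -> nat -> C) (v : nat -> C) (N : nat -> nat) (D r : C) :
  0 <= r -> r < 1 -> (forall n, (n <= N n)%N) ->
  (forall n k, `|u n k| <= D * r ^+ k) -> (forall k, (u^~ k) @ \oo --> v k) ->
  exists s : C, (fun n => \sum_(k < n) v k) @ \oo --> s /\
                (fun n => \sum_(k < N n) u n k) @ \oo --> s.
Proof.
move=> r_ge0 r_lt1 hN hu uv.
have D_ge0 : 0 <= D by have := hu 0%N 0%N; rewrite expr0 mulr1; apply: le_trans.
have hv k : `|v k| <= D * r ^+ k by apply: cvg_norm_le (uv k) _; exact: nearW.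
have : cvgn (fun n => \sum_(k < n) v k).
  apply: (is_cvg_complex_geometric_steps r_ge0 r_lt1) => n.
  by rewrite big_ord_recr /= addrAC subrr add0r; exact: hv.
move/cvg_ex => [s vs]; exists s; split=> //.
have split_sum (f : nat -> C) m n : (m <= n)%N ->
    \sum_(k < n) f k - \sum_(k < m) f k = \sum_(m <= k < n) f k.
  by move=> le_mn; rewrite -!(big_mkord predT f) (big_cat_nat _ le_mn) //= addrAC subrr add0r.
have hs m : `|s - \sum_(k < m) v k| <= D / (1 - r) * r ^+ m.
  apply: (@cvg_norm_le (fun n => \sum_(k < n) v k - \sum_(k < m) v k)).
    exact: (cvgB (f := fun n => \sum_(k < n) v k) (g := fun=> \sum_(k < m) v k) vs (cvg_cst _)).
  near=> n; rewrite split_sum; last by near: n; exact: nbhs_infty_ge.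
  exact: geometric_tail_le.
apply/cvgrPdist_lt => e e_gt0.
have e3_gt0 : 0 < e / 3%:R by rewrite divr_gt0 // ltr0n.
have /cvgrPdist_lt/(_ _ e3_gt0) : (fun m => D / (1 - r) * r ^+ m) @ \oo --> (0 : C).
  rewrite -(mulr0 (D / (1 - r))); 
  exact: (cvgM (f := fun=> _) (g := fun m => r ^+ m) (cvg_cst _) (cvg_complex_expr r_ge0 r_lt1)).
case=> m _ /(_ m (leqnn m)) /=; rewrite sub0r normrN ger0_norm; last first.
  by rewrite mulr_ge0 ?exprn_ge0 // divr_ge0 // subr_ge0 ltW.
move=> hm.
have /cvgrPdist_lt/(_ _ e3_gt0) hfin := cvg_finite_sum (n := m) uv.
near=> n.
have le_mN : (m <= N n)%N by apply: leq_trans (hN n); near: n; exact: nbhs_infty_ge.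
have -> : s - \sum_(k < N n) u n k = (s - \sum_(k < m) v k)
   + (\sum_(k < m) v k - \sum_(k < m) u n k) - (\sum_(k < N n) u n k - \sum_(k < m) u n k).
  by ring.
have -> : e = e / 3%:R + e / 3%:R + e / 3%:R by field.
apply: le_lt_trans (ler_normB _ _) _; apply: ltrD.
  apply: le_lt_trans (ler_normD _ _) _; apply: ltrD; first exact: le_lt_trans (hs m) hm.
  by near: n; exact: hfin.
rewrite split_sum //; apply: le_lt_trans hm; exact: geometric_tail_le.
Unshelve. all: by end_near. Qed.

End ComplexLimits.

(** * Limits of q-Pochhammer symbols *)

Section QPochhammerLimits.
Variable R : realType.
Local Notation C := (Cpx R).
Local Notation toC := (@real_complex_def R (Phant R)).

(** Since 1 + t <= exp t, the bound P = exp(a / (1 - r)) works. *)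
Lemma prod_one_plus_geometric_bounded (a r : C) : 0 <= a -> 0 <= r -> r < 1 ->
  exists P : C, forall n, \prod_(i < n) (1 + a * r ^+ i) <= P.
Proof.
move=> a_ge0 r_ge0 r_lt1.
have /complex_realP[x Er] := ger0_real r_ge0.
have /complex_realP[c Ea] := ger0_real a_ge0.
have c_ge0 : 0 <= c by move: a_ge0; rewrite Ea lecR.
have x_ge0 : 0 <= x by move: r_ge0; rewrite Er lecR.
have x_lt1 : x < 1 by move: r_lt1; rewrite Er ltcR.
exists (toC (expR (c / (1 - x)))) => n.
have -> : \prod_(i < n) (1 + a * r ^+ i) = toC (\prod_(i < n) (1 + c * x ^+ i)).
  rewrite rmorph_prod; apply: eq_bigr => i _.
  by rewrite rmorphD rmorph1 rmorphM rmorphXn Ea Er.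
rewrite lecR; apply: (@le_trans _ _ (expR (\sum_(i < n) c * x ^+ i))).
  elim: n => [|n IH]; first by rewrite !big_ord0 expR0.
  rewrite !big_ord_recr /= expRD ler_pM ?expR_ge1Dx //.
    by rewrite prodr_ge0 // => i _; rewrite addr_ge0 // mulr_ge0 // exprn_ge0.
  by rewrite addr_ge0 // mulr_ge0 // exprn_ge0.
rewrite ler_expR -mulr_sumr ler_wpM2l // -[_^-1]mul1r ler_pdivlMr ?subr_gt0 //.
by rewrite mulrC -opprB mulNr -subrX1 opprB lerBlDr lerDl exprn_ge0.
Qed.

Lemma qpoch_bounded (x y : C) : `|y| < 1 -> exists P : C, forall n, `|qpoch x y n| <= P.
Proof.
move=> y_lt1.
have [P hP] := prod_one_plus_geometric_bounded (normr_ge0 x) (normr_ge0 y) y_lt1.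
exists P => n; apply: le_trans (hP n); rewrite /qpoch normr_prod.
apply: ler_prod => i _; rewrite normr_ge0 /=.
by apply: le_trans (ler_normB _ _) _; rewrite normr1 normrM normrX.
Qed.

Lemma qpoch_cvg (x y : C) : `|y| < 1 -> qpoch x y @ \oo --> qpoch_inf x y.
Proof.
move=> y_lt1; have [P hP] := qpoch_bounded x y_lt1.
apply: (is_cvg_complex_geometric_steps (D := P * `|x|) (normr_ge0 y) y_lt1) => n.
rewrite qpochS mulrBr mulr1 addrAC subrr add0r normrN normrM normrM normrX.
by rewrite -mulrA ler_wpM2r ?hP // mulr_ge0 ?exprn_ge0 ?normr_ge0.
Qed.

Lemma expr_norm_lt1 (q : C) n : `|q| < 1 -> `|q ^+ n.+1| < 1.
Proof. by move=> q_lt1; rewrite normrX exprn_ilt1. Qed.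

Section Base.
Variable q : C.
Hypothesis q_lt1 : `|q| < 1.
Local Notation qp := (qpoch q q).
Local Notation gb := (gbin q).
Local Notation sc := (@signed_theta_coef C).
Local Notation qpinf := (qpoch_inf q q).

Lemma one_minus_expr_neq0 n : 1 - q ^+ n.+1 != 0.
Proof.
rewrite subr_eq0; apply/eqP => E; have := expr_norm_lt1 n q_lt1.
by rewrite -E normr1 ltxx.
Qed.
Local Notation q1 := one_minus_expr_neq0.

Lemma inv_qpoch_bounded : exists2 P : C, 0 < P & forall n, `|(qp n)^-1| <= P.
Proof.
pose r := `|q|; have r_ge0 : 0 <= r := normr_ge0 q.
have r1_gt0 : 0 < 1 - r by rewrite subr_gt0.
(* The constant 1 / (1 - r) comes from 1 / (1 - rt) <= 1 + t / (1 - r) for 0 <= t <= 1, used with t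
   = r^i. *)
have [P hP] := prod_one_plus_geometric_bounded (ltW (divr_gt0 ltr01 r1_gt0)) r_ge0 q_lt1.
exists P => [|n]; first by apply: lt_le_trans (hP 0%N); rewrite big_ord0.
apply: le_trans (hP n); rewrite /qpoch -prodfV normr_prod.
apply: ler_prod => i _; rewrite normr_ge0 /= -exprS normfV.
have t_ge0 : 0 <= r ^+ i by rewrite exprn_ge0.
have t_le1 : r ^+ i <= 1 by rewrite exprn_ile1 // ltW.
have rt_lt1 : r ^+ i.+1 < 1 by rewrite exprn_ilt1.
have le1 : 1 - r ^+ i.+1 <= `|1 - q ^+ i.+1|.
  by apply: le_trans (lerB_dist _ _); rewrite normr1 normrX.
have gt0 : 0 < 1 - r ^+ i.+1 by rewrite subr_gt0.
rewrite -[_^-1]mul1r ler_pdivrMr; last exact: lt_le_trans gt0 le1.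
have f_ge0 : 0 <= 1 + 1 / (1 - r) * r ^+ i.
  by rewrite addr_ge0 // mulr_ge0 // divr_ge0 // ltW.
apply: le_trans (ler_wpM2l f_ge0 le1); rewrite exprS -subr_ge0.
set t := r ^+ i in t_ge0 t_le1 *.
have -> : (1 + 1 / (1 - r) * t) * (1 - r * t) - 1
   = t * ((1 - r) ^+ 2 + r * (1 - t)) / (1 - r).
  by field; rewrite gt_eqF.
rewrite divr_ge0 ?(ltW r1_gt0) // mulr_ge0 // addr_ge0 ?exprn_ge0 ?(ltW r1_gt0) //.
by rewrite mulr_ge0 // subr_ge0.
Qed.

(** A zero limit would make some |(q)_m| smaller than 1 / P, while all reciprocals are bounded by
    P. *)
Lemma qpinf_neq0 : qpinf != 0.
Proof.
have [P P_gt0 hP] := inv_qpoch_bounded.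
have PV_gt0 : 0 < P^-1 by rewrite invr_gt0.
apply/eqP => E0.
have [m hm] : exists m, `|qp m| < P^-1.
  have /cvgrPdist_lt/(_ P^-1 PV_gt0) [m _ /(_ m (leqnn m)) /=] := qpoch_cvg (x := q) q_lt1.
  by rewrite E0 sub0r normrN; exists m.
have E1 : `|qp m| * `|(qp m)^-1| = 1 by rewrite -normrM divff ?normr1 // qp_neq0 //; exact: q1.
have : `|qp m| * `|(qp m)^-1| < P^-1 * P.
  by apply: le_lt_trans (ler_wpM2l (normr_ge0 _) (hP m)) _; rewrite ltr_pM2r.
by rewrite E1 mulVf ?ltxx // gt_eqF.
Qed.

Lemma qpoch_cvg_shift c : (fun n => qp (n + c)) @ \oo --> qpinf.
Proof. by have := qpoch_cvg (x := q) q_lt1; rewrite -(cvg_shiftn c). Qed.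

Lemma qpoch_cvg_center c : (fun n => qp (n - c)) @ \oo --> qpinf.
Proof. by have := qpoch_cvg (x := q) q_lt1; rewrite -(cvg_centern c). Qed.

Lemma invpair_bounded : exists2 P : C, 0 <= P & forall L g, `|invpair q L g| <= P.
Proof.
have [P P_gt0 hP] := inv_qpoch_bounded; have P_ge0 := ltW P_gt0.
exists (P * P) => [|L g]; first exact: mulr_ge0.
rewrite /invpair; case: ifP => _; last by rewrite normr0 mulr_ge0.
by rewrite invfM normrM ler_pM.
Qed.

Lemma invpair_cvg g : (fun L => invpair q L g) @ \oo --> (qpinf * qpinf)^-1.
Proof.
apply: cvg_trans (near_eq_cvg _) (cvgV (f := fun L => qp (L - g) * qp (L + g)) _
  (cvgM (f := fun L => qp (L - g)) (g := fun L => qp (L + g))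
    (qpoch_cvg_center g) (qpoch_cvg_shift g))); last by rewrite mulf_neq0 ?qpinf_neq0.
near=> L; rewrite /invpair ifT //; near: L; exact: nbhs_infty_ge.
Unshelve. all: by end_near. Qed.

Lemma gbin_bounded : exists2 G : C, 0 <= G & forall n k, `|gb n k| <= G.
Proof.
have [P P_gt0 hP] := inv_qpoch_bounded; have P_ge0 := ltW P_gt0.
have [G hG] := qpoch_bounded q q_lt1.
have G_ge0 : 0 <= G by apply: le_trans (hG 0%N).
exists (G * (P * P)) => [|n k]; first by rewrite !mulr_ge0.
rewrite /gbin; case: ifP => _; last by rewrite normr0 !mulr_ge0.
rewrite normrM; apply: ler_pM => //; first exact: hG.
by rewrite invfM normrM; apply: ler_pM.
Qed.

Lemma gbin_cvg c k : (fun n => gb (n + c) k) @ \oo --> (qp k)^-1.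
Proof.
have -> : (qp k)^-1 = qpinf * (qp k * qpinf)^-1 by field; rewrite qp_neq0 ?qpinf_neq0 //; exact: q1.
have h : (fun n => qp (n + c) * (qp k * qp (n - k + c))^-1) @ \oo --> qpinf * (qp k * qpinf)^-1.
  have hk : (fun n => qp (n - k + c)) @ \oo --> qpinf.
    by have := qpoch_cvg_shift c; rewrite -(cvg_centern k).
  apply: (cvgM (f := fun n => qp (n + c)) (g := fun n => (qp k * qp (n - k + c))^-1)
     (qpoch_cvg_shift c)).
  apply: (cvgV (f := fun n => qp k * qp (n - k + c))).
    by rewrite mulf_neq0 ?qpinf_neq0 ?qp_neq0 //; exact: q1.
  exact: (cvgM (f := fun=> qp k) (g := fun n => qp (n - k + c)) (cvg_cst _) hk).
apply: cvg_trans (near_eq_cvg _) h; near=> n.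
have le_kn : (k <= n)%N by near: n; exact: nbhs_infty_ge.
by rewrite /gbin ifT ?(leq_trans le_kn) ?leq_addr // addnBAC.
Unshelve. all: by end_near. Qed.

Lemma gbin_central_cvg j : (fun L => gb (2 * L) (L + j)) @ \oo --> qpinf^-1.
Proof.
have -> : qpinf^-1 = qpinf * (qpinf * qpinf)^-1 by field; rewrite qpinf_neq0.
have h2 : (fun L => qp (2 * L)) @ \oo --> qpinf.
  apply: (cvg_comp (fun L => 2 * L)%N qp _ (qpoch_cvg (x := q) q_lt1)).
  by apply: cvg_mulnl.
apply: cvg_trans (near_eq_cvg _) (cvgM (f := fun L => qp (2 * L))
   (g := fun L => invpair q L j) h2 (invpair_cvg j)).
near=> L.
have le_jL : (j <= L)%N by near: L; exact: nbhs_infty_ge.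
rewrite /gbin ifT; last by rewrite mul2n -addnn leq_add2l.
rewrite (_ : (2 * L - (L + j) = L - j)%N); last by lia.
by rewrite /GRing.mul_fun /= /invpair le_jL [qp (L + j) * _]mulrC.
Unshelve. all: by end_near. Qed.

Lemma signed_theta_coef_le j : `|sc j| <= 2.
Proof.
case: j => [|j] /=; first by rewrite normr1 ler1n.
by rewrite normrM normrX normrN1 expr1n mulr1 normr_nat.
Qed.

(** From e j^2 >= j comes the geometric majorant required by [tannery]. *)
Lemma norm_expr_sqr_le e j : (0 < e)%N -> `|q ^+ (e * j ^ 2)| <= `|q| ^+ j.
Proof.
move=> e_gt0; rewrite normrX; apply: ler_wiXn2l => //; first exact: ltW.
by apply: leq_trans (leq_pmull _ e_gt0); case: j => // j; rewrite -mulnn leq_pmulr.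
Qed.

End Base.
End QPochhammerLimits.

(** * The theta series and the final Bailey sum *)

Lemma mulfVK_pair (F : numFieldType) (p x : F) :
  p != 0 -> p * p * (x * (p^-1 * p^-1)) = x.
Proof. by move=> p0; field. Qed.

Section ThetaLimits.
Variable R : realType.
Local Notation C := (Cpx R).
Local Notation sc := (@signed_theta_coef C).

Lemma cvg_seq_unique (u : nat -> C) (a b : C) : u @ \oo --> a -> u @ \oo --> b -> a = b.
Proof. exact: (norm_cvg_unique (F := u @ \oo)). Qed.

Lemma cvg_seq_eq (u v : nat -> C) (a : C) :
  (forall n, u n = v n) -> u @ \oo --> a -> v @ \oo --> a.
Proof. by move=> /funext ->. Qed.

Lemma cvg_seqM (u v : nat -> C) (a b : C) :
  u @ \oo --> a -> v @ \oo --> b -> (fun n => u n * v n) @ \oo --> a * b.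
Proof. exact: cvgM. Qed.

Lemma cvg_seqZ (c : C) (u : nat -> C) (a : C) :
  u @ \oo --> a -> (fun n => c * u n) @ \oo --> c * a.
Proof. by apply: cvg_seqM; exact: cvg_cst. Qed.

Section Base.
Variable q : C.
Hypothesis q_lt1 : `|q| < 1.
Local Notation q1 := (one_minus_expr_neq0 q_lt1).
Local Notation qp := (qpoch q q).
Local Notation gb := (gbin q).
Local Notation qpinf := (qpoch_inf q q).

Lemma sqr_lt1 : `|q ^+ 2| < 1.
Proof. exact: expr_norm_lt1. Qed.

Lemma qpinf_split : qpinf = qpoch_inf q (q ^+ 2) * qpoch_inf (q ^+ 2) (q ^+ 2).
Proof.
have h2 : (fun n => qp (2 * n)) @ \oo --> qpinf.
  apply: (cvg_comp (fun n => 2 * n)%N qp _ (qpoch_cvg (x := q) q_lt1)).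
  exact: cvg_mulnl.
apply: cvg_seq_unique h2 _.
have -> : (fun n => qp (2 * n)) = (fun n => qpoch q (q ^+ 2) n * qpoch (q ^+ 2) (q ^+ 2) n).
  apply/funext; elim=> [|n IH]; first by rewrite !qpoch0 mulr1.
  rewrite mulnS !qpochS IH -!exprM -!exprS -exprD.
  by rewrite (_ : (2 + 2 * n = (2 * n).+2)%N) //; ring.
exact: cvg_seqM (qpoch_cvg sqr_lt1) (qpoch_cvg sqr_lt1).
Qed.

(** Gauss's theta product. In the seed with L = M, the left side tends to the series over (q)_oo^2
    and the right side to 1 / (q^2;q^2)_oo; [qpinf_split] then rewrites (q)_oo^2 / (q^2;q^2)_oo. *)
Lemma signed_theta_cvg : (fun n => \sum_(j < n) sc j * q ^+ (j ^ 2)) @ \oo -->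
  qpoch_inf q (q ^+ 2) * qpoch_inf q (q ^+ 2) * qpoch_inf (q ^+ 2) (q ^+ 2).
Proof.
have [G G_ge0 hG] := gbin_bounded q_lt1.
have [|L j|j|s [h1 h2]] := @tannery R
   (fun L j => sc j * q ^+ (j ^ 2) * (gb (2 * L) (L + j) * gb (2 * L) (L + j)))
   (fun j => sc j * q ^+ (j ^ 2) * (qpinf^-1 * qpinf^-1)) S (2 * (G * G)) `|q| (normr_ge0 q) q_lt1.
- by [].
- rewrite normrM mulrAC; apply: ler_pM => //.
    rewrite normrM; apply: ler_pM => //; first exact: signed_theta_coef_le.
    by have := norm_expr_sqr_le q_lt1 j (ltn0Sn 0); rewrite mul1n.
  by rewrite normrM; apply: ler_pM => //; exact: hG.
- apply: cvg_seqZ; apply: cvg_seqM; exact: gbin_central_cvg.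
have Es : s = (qpoch_inf (q ^+ 2) (q ^+ 2))^-1.
  apply: cvg_seq_unique h2 _.
  apply: cvg_seq_eq (gbin_central_cvg sqr_lt1 0) => L.
  rewrite addn0 mul2n -addnn -signed_burge_diag_sum; last exact: q1.
  apply: eq_bigr => j _; rewrite burge_diag -1?ltnS //; congr (_ * (_ * _)).
  rewrite -[in LHS]gbin_sub; last by have := leq_ord j; lia.
  by congr (gbin _ _ _); have := leq_ord j; lia.
have qi0 := qpinf_neq0 q_lt1; have qi20 := qpinf_neq0 sqr_lt1.
have <- : qpinf * qpinf * s = qpoch_inf q (q ^+ 2) * qpoch_inf q (q ^+ 2) * qpoch_inf (q ^+ 2) (q ^+ 2).
  by rewrite Es qpinf_split [X in X / _]mulrACA mulrA mulfK.
apply: cvg_seq_eq (cvg_seqZ (c := qpinf * qpinf) h1) => n; rewrite mulr_sumr.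
by apply: eq_bigr => j _; exact: mulfVK_pair.
Qed.

(** The seed for fixed L as M -> oo. The sum over j is finite, so termwise limits suffice. *)
Lemma signed_invpair_sum L :
  \sum_(j < L.+1) sc j * q ^+ (j ^ 2) * invpair q L j = (qpoch (q ^+ 2) (q ^+ 2) L)^-1.
Proof.
have h j : (fun M => sc j * q ^+ (j ^ 2) * (gb (M + L) (L - j) * gb (M + L) (L + j)))
    @ \oo --> sc j * q ^+ (j ^ 2) * ((qp (L - j))^-1 * (qp (L + j))^-1).
  by apply: cvg_seqZ; apply: cvg_seqM; apply: gbin_cvg.
rewrite [LHS](_ : _ = \sum_(j < L.+1) sc j * q ^+ (j ^ 2) * ((qp (L - j))^-1 * (qp (L + j))^-1)).
  have h' := @gbin_cvg R (q ^+ 2) sqr_lt1 L L.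
  apply: (fun h0 => cvg_seq_unique h0 h').
  apply: cvg_seq_eq (cvg_finite_sum (n := L.+1) h) => M; rewrite [(M + L)%N]addnC -signed_burge_diag_sum; last exact: q1.
  by apply: eq_bigr => j _; rewrite burge_diag // -ltnS.
apply: eq_bigr => j _; rewrite /invpair -ltnS ltn_ord invfM //.
Qed.

Lemma bailey_beta_bounded g e : (0 < e)%N ->
  exists2 B : C, 0 <= B & forall m, `|bailey_beta q g e m| <= B.
Proof.
move=> e_gt0; have [P P_ge0 hP] := invpair_bounded q_lt1.
exists (2 * P / (1 - `|q|)) => [|m].
  by rewrite divr_ge0 ?mulr_ge0 // subr_ge0 ltW.
rewrite /bailey_beta -(big_mkord predT (fun j => sc j * q ^+ (e * j ^ 2) * invpair q m (g * j))).
rewrite -[X in _ <= X]mulr1 -[X in _ <= _ * X](expr0 `|q|).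
apply: geometric_tail_le => // j; rewrite normrM mulrAC; apply: ler_pM => //; last exact: hP.
rewrite normrM; apply: ler_pM => //; first exact: signed_theta_coef_le.
exact: norm_expr_sqr_le.
Qed.

End Base.

(** This is [bailey_step] as L -> oo, with [tannery] on each side: the left side tends to the wanted
    series over (q)_oo, the right side to the theta series in Q over (q)_oo^2. *)
Lemma bailey_beta_series_cvg (q Q : C) g e : `|q| < 1 -> (0 < g)%N -> (0 < e)%N ->
  Q = q ^+ (e + g ^ 2) ->
  (fun n => \sum_(m < n) q ^+ (m ^ 2) * bailey_beta q g e m) @ \oo -->
  qpoch_inf Q (Q ^+ 2) * qpoch_inf Q (Q ^+ 2) * qpoch_inf (Q ^+ 2) (Q ^+ 2) / qpoch_inf q q.
Proof.
move=> q_lt1 g_gt0 e_gt0 EQ; have eg_gt0 : (0 < e + g ^ 2)%N by rewrite addn_gt0 e_gt0.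
have Q_lt1 : `|Q| < 1 by rewrite EQ -(prednK eg_gt0); exact: expr_norm_lt1.
have qi0 := qpinf_neq0 q_lt1.
have [P P_ge0 hP] := invpair_bounded q_lt1.
have [B B_ge0 hB] := bailey_beta_bounded q_lt1 g e_gt0.
have [P' P'_gt0 hP'] := inv_qpoch_bounded q_lt1.
set th := qpoch_inf Q _ * _ * _.
have [|L j|j|s [h1 h2]] := @tannery R
   (fun L j => sc j * q ^+ ((e + g ^ 2) * j ^ 2) * invpair q L (g * j))
   (fun j => sc j * q ^+ ((e + g ^ 2) * j ^ 2) * (qpoch_inf q q * qpoch_inf q q)^-1) S (2 * P) `|q| (normr_ge0 q) q_lt1.
- by [].
- rewrite normrM mulrAC; apply: ler_pM => //; last exact: hP.
  rewrite normrM; apply: ler_pM => //; first exact: signed_theta_coef_le.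
  exact: norm_expr_sqr_le.
- apply: cvg_seqZ; exact: invpair_cvg.
have Es : s = (qpoch_inf q q * qpoch_inf q q)^-1 * th.
  apply: cvg_seq_unique h1 _.
  have h := cvg_seqZ (c := (qpoch_inf q q * qpoch_inf q q)^-1) (signed_theta_cvg Q_lt1).
  apply: cvg_seq_eq h => n; rewrite mulr_sumr.
  apply: eq_bigr => j _; rewrite EQ -exprM; exact: mulrC.
have [|L m|m|s' [h3 h4]] := @tannery R
   (fun L m => (qpoch q q (L - m))^-1 * (q ^+ (m ^ 2) * bailey_beta q g e m))
   (fun m => (qpoch_inf q q)^-1 * (q ^+ (m ^ 2) * bailey_beta q g e m)) S (P' * B) `|q| (normr_ge0 q) q_lt1.
- by [].
- rewrite -mulrA normrM; apply: ler_pM => //; first exact: hP'.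
  rewrite normrM [B * _]mulrC; apply: ler_pM => //; last exact: hB.
  by have := norm_expr_sqr_le q_lt1 m (ltn0Sn 0); rewrite mul1n.
- have h : (fun L => (qpoch q q (L - m))^-1) @ \oo --> (qpoch_inf q q)^-1.
    exact: cvgV qi0 (qpoch_cvg_center q_lt1 m).
  apply: (cvg_seqM (v := fun=> q ^+ (m ^ 2) * bailey_beta q g e m) h).
  exact: cvg_cst.
have Es' : s' = s.
  apply: cvg_seq_unique h4 _; apply: cvg_seq_eq h2 => L.
  rewrite -[LHS]/(bailey_beta q g (e + g ^ 2) L) -bailey_step //; last exact: one_minus_expr_neq0.
  by apply: eq_bigr => m _; rewrite mulrA [X in X * _]mulrC.
have -> : th / qpoch_inf q q = qpoch_inf q q * s' by rewrite Es' Es; field.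
apply: cvg_seq_eq (cvg_seqZ (c := qpoch_inf q q) h3) => n; rewrite mulr_sumr.
by apply: eq_bigr => m _; field.
Qed.

End ThetaLimits.

(** * Box sums, the word of a continued fraction and the quadratic form *)

Lemma mextE (d N : nat) (f : {ffun 'I_d -> 'I_N}) (i : 'I_d) : mext f i.+1 = f i.
Proof. by rewrite /= ltn_ord (big_pred1 i) // => j. Qed.

Lemma mext_default (d N : nat) (f : {ffun 'I_d -> 'I_N}) j : (d <= j)%N -> mext f j.+1 = 0%N.
Proof. by rewrite /= leqNgt => /negbTE ->. Qed.

Definition cons_index (x : nat) (m : nat -> nat) (j : nat) : nat :=
  match j with 0 => 0 | 1 => x | j'.+2 => m j'.+1 end.

Lemma boxsumS (V : nmodType) d N (F : (nat -> nat) -> V) :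
  boxsum d.+1 N F = \sum_(x < N) boxsum d N (fun m => F (cons_index x m)).
Proof.
rewrite /boxsum pair_bigA /=.
pose h (p : 'I_N * {ffun 'I_d -> 'I_N}) : {ffun 'I_d.+1 -> 'I_N} :=
  [ffun i => if unlift ord0 i is Some j then p.2 j else p.1].
pose h' (f : {ffun 'I_d.+1 -> 'I_N}) : 'I_N * {ffun 'I_d -> 'I_N} :=
  (f ord0, [ffun j => f (lift ord0 j)]).
have hK : cancel h h'.
  case=> x g; rewrite /h' /h ffunE unlift_none; congr (_, _).
  by apply/ffunP => j; rewrite !ffunE liftK.
have h'K : cancel h' h.
  move=> f; apply/ffunP => i; rewrite /h /h' ffunE /=.
  by case: unliftP => [j ->|->]; rewrite ?ffunE.
rewrite (reindex h) /=; last by exists h' => x _; [exact: hK|exact: h'K].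
apply: eq_bigr => -[x g] _; congr F; apply/funext => -[|[|j]] //.
  by rewrite (mextE (h (x, g)) ord0) ffunE unlift_none.
rewrite [RHS]/=; have [le_dj|lt_jd] := leqP d j.
  by rewrite mext_default // ltnNge le_dj.
rewrite (mextE (h (x, g)) (lift ord0 (Ordinal lt_jd))) ffunE liftK.
by rewrite -(mextE g (Ordinal lt_jd)) /= lt_jd.
Qed.

(** The extra leading 0 is a dummy entry at index 0, since the variables are numbered from 1. *)
Lemma boxsumE (V : nmodType) d N (F : (nat -> nat) -> V) :
  boxsum d N F = nested_sum d N (fun s => F (nth 0%N (0%N :: s))).
Proof.
elim: d F => [|d IH] F.
  rewrite /boxsum (eq_bigr (fun=> F (nth 0%N [:: 0%N]))) => [|f _].
    by rewrite sumr_const card_ffun !card_ord expn0 mulr1n.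
  by congr F; apply/funext => -[|j] //=; rewrite nth_nil.
rewrite boxsumS /=; apply: eq_bigr => x _; rewrite IH; apply: eq_nested_sum => s _.
by congr F; apply/funext => -[|[|j]].
Qed.

Lemma in_T_cons x c j : in_T (x :: c) j = (j == x) || ((x <= j)%N && in_T c (j - x)).
Proof.
rewrite /in_T /= in_cons; congr orb; first by rewrite /cf_t /= take0 addn0.
rewrite -[2%N]/(1 + 1)%N iotaDl -map_comp.
apply/mapP/andP => [[i hi ->]|[le_xj /mapP[i hi E]]].
  by rewrite /cf_t /= leq_addr addKn; split=> //; apply/mapP; exists i.
by exists i => //; rewrite /cf_t /= -[RHS]/(x + cf_t c i)%N -E subnKC.
Qed.

Lemma in_T_sumn c : c != [::] -> in_T c (sumn c).
Proof.
case: c => // x c _; apply/mapP; exists (size (x :: c)); last by rewrite /cf_t take_size.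
by rewrite mem_iota add1n ltnS leqnn.
Qed.

Lemma in_T_shift x c j : (0 < j)%N -> in_T (x :: c) (x + j) = in_T c j.
Proof.
by move=> j_gt0; rewrite in_T_cons -[X in _ == X]addn0 eqn_add2l leq_addr addKn gtn_eqF.
Qed.

(** The last index d is always some t_i and gets no letter: its factor, in base q^2, is the seed
    reached at the end of the word. *)
Definition cf_word (c : seq nat) : seq bool := [seq in_T c j | j <- iota 1 (sumn c).-1].

Lemma cf_word_prefix x c :
  [seq in_T (x :: c) j | j <- iota 1 x.-1] = nseq x.-1 false.
Proof.
rewrite -[in RHS](size_iota 1 x.-1) -(size_map (in_T (x :: c))); apply/all_pred1P.
apply/allP => _ /mapP[j hj ->] /=; move: hj; rewrite mem_iota in_T_cons => hj.
by rewrite [(x <= j)%N]leqNgt (_ : (j < x)%N) ?orbF; [apply/eqP/negbTE|]; lia.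
Qed.

Lemma cf_word_cons x c : (0 < x)%N -> (0 < sumn c)%N ->
  cf_word (x :: c) = nseq x.-1 false ++ true :: cf_word c.
Proof.
move=> x_gt0 c_gt0; rewrite /cf_word /=.
rewrite (_ : (x + sumn c).-1 = x.-1 + (sumn c).-1.+1)%N; last by lia.
rewrite iotaD map_cat cf_word_prefix; congr cat.
rewrite add1n prednK //= in_T_cons eqxx; congr cons.
rewrite -[x.+1]addn1 iotaDl -map_comp; apply/eq_in_map => j.
by rewrite mem_iota /= => /andP[j_gt0 _]; exact: in_T_shift.
Qed.

Lemma slope_nseq n w :
  slope (nseq n false ++ w) = ((slope w).1 + n * (slope w).2, (slope w).2)%N.
Proof.
elim: n => [|n IH] /=; first by rewrite mul0n addn0; case: slope.
by rewrite IH /slope_step /=; congr pair; lia.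
Qed.

Lemma cf_word1 x : (0 < x)%N -> slope (cf_word [:: x]) = (x, 1)%N.
Proof.
move=> x_gt0; rewrite /cf_word /= addn0.
have -> : [seq in_T [:: x] j | j <- iota 1 x.-1] = nseq x.-1 false ++ [::].
  by rewrite cats0 cf_word_prefix.
by rewrite slope_nseq /= muln1 add1n prednK.
Qed.

(** On ratios, (u,v) -> (xu + v, u) is u/v -> x + 1/(u/v), which is why the slope reproduces
    [cfval]. *)
Lemma slope_cf_word x c : (0 < x)%N -> (0 < sumn c)%N ->
  slope (cf_word (x :: c))
  = (x * (slope (cf_word c)).1 + (slope (cf_word c)).2, (slope (cf_word c)).1)%N.
Proof.
move=> x_gt0 c_gt0; rewrite cf_word_cons // slope_nseq /=; congr pair.
by case: x x_gt0 => // x _ /=; lia.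
Qed.

Lemma cfvalE c : c != [::] -> all (fun x => 0 < x)%N c ->
  let p := slope (cf_word c) in cfval c = p.1%:R / p.2%:R /\ coprime p.1 p.2.
Proof.
elim: c => // x c IH _ /= /andP[x_gt0 c_pos].
case: c IH c_pos => [|y c] IH c_pos; first by rewrite cf_word1 // divr1 coprimen1.
have c_gt0 : (0 < sumn (y :: c))%N by move: c_pos => /= /andP[]; lia.
have [|E cop] := IH _ c_pos; first by [].
rewrite slope_cf_word //; have /andP[] := slope_gt0 (cf_word (y :: c)).
move: E cop; rewrite -/(cfval (y :: c)); case: (slope _) => u v /= -> cop u_gt0 v_gt0.
split; last by rewrite coprime_sym /coprime gcdnMDl.
have u0 : u%:R != 0 :> rat by rewrite pnatr_eq0 -lt0n.
have v0 : v%:R != 0 :> rat by rewrite pnatr_eq0 -lt0n.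
by rewrite natrD natrM; field; rewrite u0 v0.
Qed.

Section QuadraticForm.
Variables (cfl : seq nat) (d : nat) (v : nat -> nat).
Hypothesis v_default : forall j, (d < j)%N -> v j = 0%N.
Local Notation T := (in_T cfl).
Local Notation Cm := (cfC cfl).

Lemma sum_delta p e j (f : nat -> int) :
  \sum_(p <= k < e) delta j k * f k = if (p <= j < e)%N then f j else 0.
Proof.
case: ifP => [h|h].
  rewrite (big_rem j) ?mem_index_iota //= /delta eqxx mul1r big_seq big1 ?addr0 // => k.
  by rewrite mem_rem_uniq ?iota_uniq // inE => /andP[/negbTE]; rewrite eq_sym => -> _; rewrite mul0r.
rewrite big_seq big1 // => k; rewrite mem_index_iota => hk.
by rewrite /delta; case: eqP => [jk|_]; rewrite ?mul0r //; rewrite jk hk in h.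
Qed.

(** The lower bound p is 1 in the first identity and a_0 + 1 in the second; row p lacks its left
    neighbour. In row d the term v_(d+1) is 0 by [v_default]. *)
Lemma cfC_row p j : (0 < p)%N -> (p <= j <= d)%N ->
  \sum_(p <= k < d.+1) Cm j k * (v k)%:Z
  = (if T j then (v j)%:Z + (v j.+1)%:Z else 2 * (v j)%:Z - (v j.+1)%:Z)
    - (if (p < j)%N then (v j.-1)%:Z else 0).
Proof.
move=> p_gt0 /andP[le_pj le_jd].
have E1 : \sum_(p <= k < d.+1) delta j k * (v k)%:Z = (v j)%:Z.
  by rewrite (sum_delta _ _ _ (fun k => (v k)%:Z)) le_pj ltnS le_jd.
have E2 : \sum_(p <= k < d.+1) delta j k.+1 * (v k)%:Z
    = if (p < j)%N then (v j.-1)%:Z else 0.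
  rewrite (eq_bigr (fun k => delta j.-1 k * (v k)%:Z)) => [|k _].
    rewrite (sum_delta _ _ _ (fun k => (v k)%:Z)) (_ : (j.-1 < d.+1)%N) ?andbT; last by lia.
    by rewrite (_ : (p <= j.-1)%N = (p < j)%N) //; lia.
  by rewrite /delta (_ : (j == k.+1) = (j.-1 == k)) //; lia.
have E3 : \sum_(p <= k < d.+1) delta j k.-1 *~ (0 < k)%N * (v k)%:Z = (v j.+1)%:Z.
  rewrite (eq_big_nat _ _ (F2 := fun k => delta j.+1 k * (v k)%:Z)) => [|k /andP[le_pk _]].
    rewrite (sum_delta _ _ _ (fun k => (v k)%:Z)); case: ifP => // h.
    by rewrite v_default //; lia.
  have k_gt0 : (0 < k)%N by lia.
  by rewrite k_gt0 mulr1z /delta (_ : (j == k.-1) = (j.+1 == k)) //; lia.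
case: ifP => Tj.
  rewrite (eq_bigr (fun k => delta j k * (v k)%:Z + delta j k.-1 *~ (0 < k)%N * (v k)%:Z
     - delta j k.+1 * (v k)%:Z)) => [|k _].
    by rewrite sumrB big_split /= E1 E2 E3.
  by rewrite /cfC /cfI Tj /=; ring.
rewrite (eq_bigr (fun k => 2 * (delta j k * (v k)%:Z) - delta j k.-1 *~ (0 < k)%N * (v k)%:Z
   - delta j k.+1 * (v k)%:Z)) => [|k _].
  by rewrite !sumrB -mulr_sumr E1 E2 E3.
by rewrite /cfC /cfI Tj /=; ring.
Qed.

(* With g_j = v_j^2 - v_(j-1) v_j, row j of the form is
   step_exp + g_j - g_(j+1), so the sum telescopes. *)
Lemma quadratic_form p : (0 < p <= d)%N -> T d ->
  \sum_(p <= j < d.+1) \sum_(p <= k < d.+1) (v j)%:Z * Cm j k * (v k)%:Z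
  = (v p ^ 2 + \sum_(p <= j < d) step_exp (T j) (v j) (v j.+1))%N%:Z.
Proof.
move=> /andP[p_gt0 le_pd] Td.
pose g j : int := (v j)%:Z ^+ 2 - (if (p < j)%N then (v j.-1)%:Z else 0) * (v j)%:Z.
have step_expE t y z : (step_exp t y z)%:Z
    = if t then z%:Z ^+ 2 else (y%:Z - z%:Z) ^+ 2.
  case: t; rewrite /step_exp; first by rewrite -mulnn PoszM expr2.
  by rewrite -mulnn PoszM abszE -expr2 real_normK // num_real.
have pull j : \sum_(p <= k < d.+1) (v j)%:Z * Cm j k * (v k)%:Z
    = (v j)%:Z * \sum_(p <= k < d.+1) Cm j k * (v k)%:Z.
  by rewrite mulr_sumr; apply: eq_bigr => k _; rewrite mulrA.
have row j : (p <= j < d)%N ->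
    \sum_(p <= k < d.+1) (v j)%:Z * Cm j k * (v k)%:Z
    = (step_exp (T j) (v j) (v j.+1))%:Z - (g j.+1 - g j).
  move=> hj; rewrite pull cfC_row //; last by lia.
  rewrite step_expE /g (_ : (p < j.+1)%N); last by lia.
  by case: ifP => _; case: ifP => _ /=; ring.
rewrite big_nat_recr //= (eq_big_nat _ _ row) sumrB telescope_sumr // opprB.
(* Row d equals g_d and cancels the upper end of the telescoping, leaving g_p = v_p^2. *)
rewrite pull cfC_row ?le_pd ?leqnn // Td (v_default (ltnSn d)) addr0.
rewrite PoszD -mulnn PoszM raddf_sum /= /g ltnn; case: ifP => _; ring.
Qed.
End QuadraticForm.

Section ChainProduct.
Variables (K : numFieldType) (q : K) (T : nat -> bool) (d : nat) (v : nat -> nat).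

Definition binom_factor (j : nat) : K :=
  if (j < d)%N
  then qbinom q ((2 * v j)%N%:Z + step_n (T j) (v j.-1) (v j) (v j.+1)) (2 * v j)%N%:Z
  else qbinom (q ^+ 2) ((v d)%:Z + ((v d.-1)%:Z - (v d)%:Z)) (v d)%:Z.

Lemma chainE r p : (0 < p)%N -> (p + r)%N = d ->
  chain q [seq T j | j <- iota p r] (v p.-1) (v p) [seq v j | j <- iota p.+1 r]
  = q ^+ (\sum_(p <= j < d) step_exp (T j) (v j) (v j.+1))
    * \prod_(p <= j < d.+1) binom_factor j.
Proof.
elim: r p => [|r IH] p p_gt0 E.
  rewrite -E addn0 big_geq // expr0 mul1r big_nat1 /= /binom_factor -E addn0 ltnn.
  by [].
have lt_pd : (p < d)%N by lia.
rewrite /= (IH p.+1) //; last by lia.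
rewrite [in RHS](big_ltn lt_pd) [in RHS](big_ltn (leqW lt_pd)) exprD /binom_factor lt_pd.
by ring.
Qed.

Lemma top_chainE p : (0 < p <= d)%N ->
  top_chain q [seq T j | j <- iota p (d - p)] (v p) [seq v j | j <- iota p.+1 (d - p)]
  = q ^+ (\sum_(p <= j < d) step_exp (T j) (v j) (v j.+1))
    / (if (p < d)%N then qpoch q q (2 * v p) else qpoch (q ^+ 2) (q ^+ 2) (v p))
    * \prod_(p.+1 <= j < d.+1) binom_factor j.
Proof.
move=> /andP[p_gt0]; rewrite leq_eqVlt => /predU1P[->|lt_pd].
  by rewrite subnn ltnn !big_geq // expr0 mulr1 mul1r.
rewrite lt_pd (_ : (d - p = (d - p.+1).+1)%N); last by lia.
rewrite /= (@chainE _ p.+1) //; last by lia.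
rewrite [in RHS](big_ltn lt_pd) exprD; ring.
Qed.
End ChainProduct.

(** * Box sums in the variables n_1, ..., n_(a0) *)

Lemma nested_sum_cat (V : nmodType) a b N (F : seq nat -> V) :
  nested_sum (a + b) N F
  = nested_sum a N (fun s => nested_sum b N (fun t => F (s ++ t))).
Proof.
elim: a F => [|a IH] F //=; apply: eq_bigr => x _; exact: IH.
Qed.

Section BoxWeights.
Variables (K : numFieldType) (q : K).
Local Notation qp := (qpoch q q).

(** For s = (n_1, ..., n_k) the squares are (N_i + m)^2 with N_i = n_i + ... + n_k. The square m^2
    is kept apart and goes with the inner sum. *)
Fixpoint tower_weight (s : seq nat) (m : nat) : K :=
  if s is x :: s' then q ^+ ((x + sumn s' + m) ^ 2) / qp x * tower_weight s' m else 1.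

Lemma tower_weightE s m : tower_weight s m
  = q ^+ (\sum_(i < size s) (sumn (drop i s) + m) ^ 2) / \prod_(x <- s) qp x.
Proof.
elim: s => [|x s IH] /=; first by rewrite big_ord0 big_nil expr0 divr1.
by rewrite IH big_ord_recl big_cons /= exprD invfM; ring.
Qed.

(* The total weight of the points of the box [0,N)^(k+1) with n_1 + ... + n_k + m = M.
   For M < N the box imposes no restriction, and the Bailey lemma applies. *)
Fixpoint box_weight (N : nat) (f : nat -> K) (k M : nat) : K :=
  if k is k'.+1 then
    \sum_(n < M.+1) (if (n < N)%N then q ^+ (M ^ 2) / qp n * box_weight N f k' (M - n) else 0)
  else if (M < N)%N then f M else 0.

Lemma box_weight_large N f k M : (k.+1 * N <= M)%N -> box_weight N f k M = 0.
Proof.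
elim: k M => [|k IH] M /= hM; first by rewrite ltnNge -[N]mul1n hM.
rewrite big1 // => n _; case: ifP => // lt_nN; rewrite IH ?mulr0 //.
by rewrite mulSn in hM; lia.
Qed.

(** Grouping by M, the sum of all the variables. The function g is arbitrary so that the induction
    can absorb q^((n+M)^2) / (q)_n into it; (k+1)N exceeds every M that occurs. *)
Lemma box_weight_sum k N (f g : nat -> K) :
  nested_sum k N (fun s => \sum_(m < N) tower_weight s m * f m * g (sumn s + m)%N)
  = \sum_(M < k.+1 * N) box_weight N f k M * g M.
Proof.
elim: k g => [|k IH] g.
  rewrite mul1n /=; apply: eq_bigr => m _; by rewrite ltn_ord mul1r.
rewrite [LHS]/=; transitivity (\sum_(n < N) \sum_(M < k.+1 * N)
     box_weight N f k M * (q ^+ ((n + M) ^ 2) / qp n * g (n + M)%N)).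
  apply: eq_bigr => n _; rewrite -(IH (fun M => q ^+ ((n + M) ^ 2) / qp n * g (n + M)%N)).
  apply: eq_nested_sum => s _; apply: eq_bigr => m _ /=.
  by rewrite !addnA; ring.
pose h M n := if (n < N)%N && (n <= M)%N
  then q ^+ (M ^ 2) / qp n * box_weight N f k (M - n) * g M else 0.
transitivity (\sum_(M < k.+2 * N) \sum_(n < N) h M n); last first.
  apply: eq_bigr => M _.
  rewrite (sum_ord_support (n := M.+1) (f := h M)).
  - rewrite mulr_suml; apply: eq_bigr => n _; rewrite /h leq_ord andbT.
    by case: ifP; rewrite ?mul0r.
  - by move=> n le_Nn; rewrite /h ltnNge le_Nn.
  - by move=> n lt_Mn; rewrite /h [(n <= M)%N]leqNgt lt_Mn andbF.
rewrite [RHS]exchange_big; apply: eq_bigr => n _.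
have lt_nN := ltn_ord n.
rewrite [in RHS](_ : (k.+2 * N = n + (k.+2 * N - n))%N); last by rewrite mulSn; lia.
rewrite [RHS]big_split_ord /= [X in _ = X + _]big1 ?add0r => [|M _]; last first.
  by rewrite /h [(n <= M)%N]leqNgt (ltn_ord M) andbF.
rewrite (sum_ord_support (n := (k.+2 * N - n)%N) (f := fun M =>
   box_weight N f k M * (q ^+ ((n + M) ^ 2) / qp n * g (n + M)%N))).
- apply: eq_bigr => M _; rewrite /h lt_nN leq_addr addKn /=; ring.
- by move=> M hM; rewrite box_weight_large ?mul0r.
- move=> M hM; rewrite box_weight_large ?mul0r //.
  by apply: leq_trans hM; rewrite mulSn; lia.
Qed.

Hypothesis q1 : forall n, 1 - q ^+ n.+1 != 0.

Lemma box_weight_bailey g e k N M : (0 < g)%N -> (M < N)%N ->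
  box_weight N (fun m => q ^+ (m ^ 2) * bailey_beta q g e m) k M
  = q ^+ (M ^ 2) * bailey_beta q g (e + k * g ^ 2) M.
Proof.
move=> g_gt0; elim: k M => [|k IH] M lt_MN /=; first by rewrite lt_MN mul0n addn0.
rewrite (_ : (e + k.+1 * g ^ 2 = e + k * g ^ 2 + g ^ 2)%N); last by lia.
rewrite -bailey_step // mulr_sumr (reindex_inj rev_ord_inj) /=.
apply: eq_bigr => m _; have le_mM := leq_ord m.
rewrite subSS subKn // IH ?(leq_ltn_trans le_mM) // ifT; last by lia.
by ring.
Qed.

End BoxWeights.

Section BoxLimit.
Variables (R : realType) (q : Cpx R).
Hypothesis q_lt1 : `|q| < 1.
Local Notation q1 := (one_minus_expr_neq0 q_lt1).

(** Each layer supplies |q|^(M^2) <= |q|^M, and the convolution leaves a geometric series bounded by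
    1 / (1 - |q|). For [tannery], B must not depend on N. *)
Lemma box_weight_bounded (f : nat -> Cpx R) (D : Cpx R) k :
  0 <= D -> (forall m, `|f m| <= D * `|q| ^+ m) ->
  exists2 B : Cpx R, 0 <= B & forall N M, `|box_weight q N f k M| <= B * `|q| ^+ M.
Proof.
move=> D_ge0 hf; elim: k => [|k [B B_ge0 hB]].
  exists D => // N M /=; case: ifP => _ //; by rewrite normr0 mulr_ge0 ?exprn_ge0.
have [P P_gt0 hP] := inv_qpoch_bounded q_lt1; have P_ge0 := ltW P_gt0.
have r1_gt0 : 0 < 1 - `|q| by rewrite subr_gt0.
exists (P * B / (1 - `|q|)) => [|N M].
  by rewrite divr_ge0 ?mulr_ge0 // ltW.
apply: le_trans (ler_norm_sum _ _ _) _.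
apply: (@le_trans _ _ (\sum_(n < M.+1) `|q| ^+ M * (P * B) * `|q| ^+ (M - n))).
  apply: ler_sum => n _; case: ifP => _; last by rewrite normr0 !mulr_ge0 ?exprn_ge0.
  rewrite !normrM -!mulrA; apply: ler_pM; rewrite ?mulr_ge0 //.
    by have := norm_expr_sqr_le q_lt1 M (ltn0Sn 0); rewrite mul1n.
  by apply: ler_pM => //; [exact: hP|exact: hB].
rewrite -mulr_sumr (reindex_inj rev_ord_inj) /=.
under eq_bigr => n _ do rewrite subSS subKn ?leq_ord //.
rewrite [`|q| ^+ M * _]mulrC -[X in _ <= X]mulrA [_^-1 * _]mulrC [X in _ <= X]mulrA.
apply: ler_wpM2l; first by rewrite !mulr_ge0 ?exprn_ge0.
exact: geometric_sum_le.
Qed.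

Lemma top_chain_sum_all w N y : (y < N)%N ->
  nested_sum (size w) N (top_chain q w y)
  = bailey_beta q (slope w).1 ((slope w).1 * (slope w).2) y.
Proof.
case: w => [|t w] lt_yN; last by apply: top_chain_sum => //; exact: q1.
rewrite /= -signed_invpair_sum //; apply: eq_bigr => j _.
by rewrite !mul1n.
Qed.

(** As m < N, each sum over t is complete and equals [bailey_beta] with exponent ab. The k outer
    sums add ka^2, and the last one, over M, adds a^2. *)
Lemma tower_series_cvg (Q : Cpx R) w k a b :
  slope w = (a, b) -> Q = q ^+ (a * (b + k.+1 * a)) ->
  (fun N => nested_sum k N (fun s => \sum_(m < N) nested_sum (size w) N (fun t =>
     tower_weight q s m * (q ^+ (m ^ 2) * top_chain q w m t)))) @ \oo -->
  qpoch_inf Q (Q ^+ 2) * qpoch_inf Q (Q ^+ 2) * qpoch_inf (Q ^+ 2) (Q ^+ 2) / qpoch_inf q q.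
Proof.
move=> Ew EQ; have := slope_gt0 w; have := @top_chain_sum_all w.
rewrite Ew => tcs /andP[a_gt0 b_gt0].
have ab_gt0 : (0 < a * b)%N by rewrite muln_gt0 a_gt0.
pose f m := q ^+ (m ^ 2) * bailey_beta q a (a * b) m.
have E N : nested_sum k N (fun s => \sum_(m < N) nested_sum (size w) N (fun t =>
     tower_weight q s m * (q ^+ (m ^ 2) * top_chain q w m t)))
   = \sum_(M < k.+1 * N) box_weight q N f k M.
  transitivity (\sum_(M < k.+1 * N) box_weight q N f k M * 1); last first.
    by apply: eq_bigr => M _; rewrite mulr1.
  rewrite -(box_weight_sum q k N f (fun=> 1)); apply: eq_nested_sum => s _.
  apply: eq_bigr => m _; rewrite !nested_sumZ tcs // mulr1 //.
have [B B_ge0 hB] := bailey_beta_bounded q_lt1 a ab_gt0.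
have [|D D_ge0 hD] := @box_weight_bounded f B k B_ge0.
  move=> m; rewrite normrM mulrC; apply: ler_pM => //; first exact: hB.
  by have := norm_expr_sqr_le q_lt1 m (ltn0Sn 0); rewrite mul1n.
have [|N M|M|s [h1 h2]] := @tannery R (fun N M => box_weight q N f k M)
   (fun M => q ^+ (M ^ 2) * bailey_beta q a (a * b + k * a ^ 2) M)
   (fun N => (k.+1 * N)%N) D `|q| (normr_ge0 q) q_lt1.
- by move=> n; rewrite leq_pmull.
- exact: hD.
- apply: cvg_trans (near_eq_cvg _) (cvg_cst _); near=> N.
  rewrite box_weight_bailey //; first exact: q1.
  by near: N; exact: nbhs_infty_gt.
apply: cvg_seq_eq (fun N => esym (E N)) _.
have EQ' : Q = q ^+ (a * b + k * a ^ 2 + a ^ 2) by rewrite EQ; congr (_ ^+ _); lia.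
have h3 := bailey_beta_series_cvg q_lt1 a_gt0 (ltn_addr (k * a ^ 2) ab_gt0) EQ'.
have Es := cvg_seq_unique h1 h3.
rewrite Es in h2; exact: h2.
Unshelve. all: by end_near. Qed.

End BoxLimit.

(** * The summands *)

Lemma binom_factorE (K : numFieldType) (q : K) cfl v p j :
  (forall i, (cf_d cfl < i)%N -> v i = 0%N) -> in_T cfl (cf_d cfl) ->
  (0 < p)%N -> (p < j <= cf_d cfl)%N ->
  qbinom (q ^+ taub cfl j)
    ((tau cfl j * v j)%N%:Z - \sum_(p <= k < (cf_d cfl).+1) cfC cfl j k * (v k)%:Z)
    (tau cfl j * v j)%N%:Z
  = binom_factor q (in_T cfl) (cf_d cfl) v j.
Proof.
move=> v_default Td p_gt0 /andP[lt_pj le_jd].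
rewrite (@cfC_row cfl (cf_d cfl) v v_default p j) ?(ltnW lt_pj) // lt_pj /binom_factor /taub /tau.
move: le_jd; rewrite leq_eqVlt => /predU1P[->|lt_jd].
  rewrite ltnn Td (v_default _ (ltnSn _)) addr0 mul1n.
  by congr qbinom; ring.
rewrite lt_jd expr1; congr qbinom; rewrite /step_n.
by case: ifP => _; lia.
Qed.

Lemma map_nth_iota_drop (s : seq nat) i n : (i + n)%N = size s ->
  [seq nth 0%N s j | j <- iota i n] = drop i s.
Proof.
move=> E; rewrite map_nth_iota; last by rewrite -E addKn.
by rewrite take_oversize // size_drop -E addKn.
Qed.

Section Summands.
Variables (R : realType) (q : Cpx R) (cfl : seq nat).
Hypothesis cfl_neq0 : cfl != [::].
Local Notation d := (cf_d cfl).
Local Notation a0 := (cf_a0 cfl).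

Let Td : in_T cfl d := in_T_sumn cfl_neq0.

Lemma summandA_chain x s : (1 < d)%N -> size s = d.-1 ->
  summandA cfl q (nth 0%N (0%N :: x :: s)) = q ^+ (x ^ 2) * top_chain q (cf_word cfl) x s.
Proof.
move=> d_gt1 size_s; set v := nth _ _.
have v_default j : (d < j)%N -> v j = 0%N.
  by move=> lt_dj; rewrite /v nth_default //= size_s; lia.
have hs : [seq v j | j <- iota 2 (d - 1)] = s.
  by rewrite map_nth_iota_drop /= ?drop0 // size_s; lia.
have hw : [seq in_T cfl j | j <- iota 1 (d - 1)] = cf_word cfl by rewrite subn1.
have -> : top_chain q (cf_word cfl) x s = top_chain q [seq in_T cfl j | j <- iota 1 (d - 1)]
   (v 1%N) [seq v j | j <- iota 2 (d - 1)] by rewrite hs hw.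
rewrite top_chainE; last by lia.
rewrite /summandA (@quadratic_form cfl d v v_default 1) //; last by lia.
rewrite -exprnP exprD d_gt1 -!mulrA; congr (_ * (_ * (_ * _))).
by apply: eq_big_nat => j hj; rewrite -(binom_factorE q v_default Td (p := 1)).
Qed.

Lemma NB_sum t u i : size t = a0 -> (i < a0)%N ->
  NB cfl (nth 0%N (0%N :: t ++ u)) i.+1 = (sumn (drop i t))%:Z.
Proof.
move=> size_t lt_ia; rewrite /NB (eq_big_nat _ _ (F2 := fun l => (nth 0%N t l.-1)%:Z)); last first.
  move=> l /andP[lt_il le_la]; rewrite /nB -ltnS le_la; case: l lt_il le_la => // l _ lt_la.
  by rewrite /= nth_cat size_t -ltnS lt_la.
rewrite big_add1 /= sumnE [in RHS](big_nth 0%N) size_drop size_t raddf_sum /=.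
rewrite -[i in X in X = _]add0n big_addn !big_mkord.
by apply: eq_bigr => k _; rewrite nth_drop addnC.
Qed.

Lemma NB_square_sum t u m : size t = a0 ->
  \sum_(1 <= i < a0.+1) (NB cfl (nth 0%N (0%N :: t ++ u)) i + m%:Z) ^+ 2
  = (\sum_(i < size t) (sumn (drop i t) + m) ^ 2)%N%:Z.
Proof.
move=> size_t; rewrite big_add1 /= big_mkord raddf_sum size_t /=.
apply: eq_bigr => i _; rewrite NB_sum // -mulnn PoszM expr2; congr (_ * _).
Qed.

Lemma prod_nth_qpoch t u : \prod_(1 <= i < (size t).+1) qpoch q q (nth 0%N (0%N :: t ++ u) i)
  = \prod_(x <- t) qpoch q q x.
Proof.
rewrite big_add1 /= [RHS](big_nth 0%N); apply: eq_big_nat => i /andP[_ lt_it].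
by rewrite nth_cat lt_it.
Qed.

Lemma summandB_chain c s m t : cfl = a0 :: c -> all (fun x => 0 < x)%N cfl -> c != [::] ->
  size s = a0 -> size t = size (cf_word c) ->
  summandB cfl q (nth 0%N (0%N :: s ++ m :: t))
  = tower_weight q s m * (q ^+ (m ^ 2) * top_chain q (cf_word c) m t).
Proof.
move=> Ecfl cfl_pos c_neq0 size_s size_t; set v := nth _ _.
have [a0_gt0 c_pos] : (0 < a0)%N /\ all (fun x => 0 < x)%N c.
  by move: cfl_pos; rewrite Ecfl => /andP[].
have c_gt0 : (0 < sumn c)%N by case: (c) c_neq0 c_pos => //= x c' _ /andP[]; lia.
have Ed : d = (a0 + sumn c)%N by rewrite [in LHS]/cf_d [in LHS]Ecfl.
have size_w : size (cf_word c) = (sumn c).-1 by rewrite size_map size_iota.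
have v_default j : (d < j)%N -> v j = 0%N.
  move=> lt_dj; rewrite /v nth_default //= size_cat /= size_s size_t size_w; lia.
have vm : v a0.+1 = m by rewrite /v /= nth_cat size_s ltnn subnn.
have hs : [seq v j | j <- iota a0.+2 (d - a0.+1)] = t.
  rewrite map_nth_iota_drop /=; last by rewrite size_cat /= size_s size_t size_w Ed; lia.
  by rewrite -[a0.+1]add1n -size_s -drop_drop drop_size_cat //= drop0.
(* Past a_0, the break points of [cfl] are those of [c] moved by a_0. *)
have hw : [seq in_T cfl j | j <- iota a0.+1 (d - a0.+1)] = cf_word c.
  rewrite -[X in iota X _]addn1 iotaDl -map_comp /cf_word Ed.
  rewrite (_ : (a0 + sumn c - a0.+1 = (sumn c).-1)%N); last by lia.
  by apply/eq_in_map => j; rewrite mem_iota [in LHS]Ecfl => /andP[j_gt0 _] /=; rewrite in_T_shift.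
have -> : top_chain q (cf_word c) m t
   = top_chain q [seq in_T cfl j | j <- iota a0.+1 (d - a0.+1)]
       (v a0.+1) [seq v j | j <- iota a0.+2 (d - a0.+1)] by rewrite hs hw vm.
rewrite top_chainE; last by lia.
rewrite /summandB (@quadratic_form cfl d v v_default a0.+1) //; last by lia.
rewrite vm NB_square_sum // -PoszD -exprnP tower_weightE.
have lt_ad : (a0 < d)%N by lia.
(* Since a_0 < d, the factor of n_(a_0) has base q and joins the product over the other n_i. *)
rewrite (_ : taub cfl a0 = 1%N) ?expr1; last by rewrite /taub /tau lt_ad.
have va : v a0 = nth 0%N (0%N :: s ++ m :: t) a0 by [].
have -> : \prod_(1 <= i < a0) qpoch q q (v i) * qpoch q q (v a0) = \prod_(x <- s) qpoch q q x.
  rewrite -(prod_nth_qpoch s (m :: t)) size_s -/v.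
  by rewrite big_nat_recr.
have -> : qpoch (q ^+ taub cfl a0.+1) (q ^+ taub cfl a0.+1) (tau cfl a0.+1 * m)
   = if (a0.+1 < d)%N then qpoch q q (2 * m) else qpoch (q ^+ 2) (q ^+ 2) m.
  by rewrite /taub /tau; case: ifP => _; rewrite ?expr1 ?mul1n.
have -> : \prod_(a0.+2 <= j < d.+1) qbinom (q ^+ taub cfl j)
   ((tau cfl j * v j)%N%:Z + nB cfl v j) (tau cfl j * v j)%N%:Z
   = \prod_(a0.+2 <= j < d.+1) binom_factor q (in_T cfl) d v j.
  apply: eq_big_nat => j hj; rewrite -(binom_factorE q v_default Td (p := a0.+1)) //.
  by rewrite /nB leqNgt (_ : (a0 < j)%N) //; lia.
rewrite !exprD invfM.
set x := \prod_(x <- s) _; set y := if _ then _ else _; set z := \prod_(_ <= j < _) _.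
by move: (x^-1) (y^-1) z => {}x {}y z; ring.
Qed.

(** With a single partial quotient, n_(a_0) plays the part of m: as a_0 = d its factor has base q^2,
    which is the empty word of [top_chain], and its square is the last N_i^2. *)
Lemma summandB_single s n : cfl = [:: a0] -> (0 < a0)%N -> size s = a0.-1 ->
  summandB cfl q (nth 0%N (0%N :: s ++ [:: n]))
  = tower_weight q s n * (q ^+ (n ^ 2) * top_chain q [::] n [::]).
Proof.
move=> Ecfl a0_gt0 size_s; set v := nth _ _.
have Ed : d = a0 by rewrite [in LHS]/cf_d [in LHS]Ecfl /= addn0.
have size_t : size (s ++ [:: n]) = a0 by rewrite size_cat size_s addn1 prednK.
have vS : v a0.+1 = 0%N by rewrite /v nth_default //= size_t.
have va : v a0 = n.
  by rewrite /v -(prednK a0_gt0) /= nth_cat size_s ltnn subnn.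
rewrite /summandB Ed vS muln0 qpoch0 mulr1.
rewrite [X in _ ^ (_ + X)]big_geq // addr0 [X in _ * X = _]big_geq // mulr1.
rewrite (_ : taub cfl a0 = 2%N); last by rewrite /taub /tau Ed ltnn.
have := NB_square_sum [::] 0 size_t; rewrite cats0 -/v => ->.
rewrite -exprnP tower_weightE va.
have -> : \prod_(1 <= i < a0) qpoch q q (v i) = \prod_(x <- s) qpoch q q x.
  by rewrite -(prod_nth_qpoch s [:: n]) size_s prednK.
have -> : (\sum_(i < size (s ++ [:: n])) (sumn (drop i (s ++ [:: n])) + 0) ^ 2
   = \sum_(i < size s) (sumn (drop i s) + n) ^ 2 + n ^ 2)%N.
  rewrite size_cat addn1 big_ord_recr /= drop_size_cat //= !addn0; congr (_ + _)%N.
  apply: eq_bigr => i _; rewrite drop_cat ltn_ord sumn_cat /= !addn0 //.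
rewrite exprD invfM /=; set x := \prod_(x <- s) _; set y := qpoch _ _ n.
by move: (x^-1) (y^-1) => {}x {}y; ring.
Qed.
End Summands.

(** * The exponent ab recovered from the continued fraction *)

Lemma coprime_ratio_eq (a b c e : nat) : (0 < b)%N -> (0 < e)%N ->
  coprime a b -> coprime c e -> a%:R / b%:R = c%:R / e%:R :> rat -> a = c /\ b = e.
Proof.
move=> b_gt0 e_gt0 cop_ab cop_ce E.
have b0 : b%:R != 0 :> rat by rewrite pnatr_eq0 -lt0n.
have e0 : e%:R != 0 :> rat by rewrite pnatr_eq0 -lt0n.
have {}E : (a * e = c * b)%N.
  apply/eqP; rewrite -(eqr_nat rat) !natrM; apply/eqP.
  by move/eqP: E; rewrite eqr_div // => /eqP.
have Ea : a = c.
  apply/eqP; rewrite eqn_dvd -(Gauss_dvdl c cop_ab) -E dvdn_mulr //=.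
  by rewrite -(Gauss_dvdl a cop_ce) E dvdn_mulr.
split=> //; apply/eqP; rewrite eqn_dvd.
rewrite -(@Gauss_dvdr b a) 1?coprime_sym // E dvdn_mull //=.
by rewrite -(@Gauss_dvdr e c) 1?coprime_sym // -E dvdn_mull.
Qed.

Lemma boxsum_tower_cvg (R : realType) (q Q : Cpx R) d w k a b (F : (nat -> nat) -> Cpx R) :
  `|q| < 1 -> slope w = (a, b) -> Q = q ^+ (a * (b + k.+1 * a)) ->
  d = (k + (size w).+1)%N ->
  (forall s m t, size s = k -> size t = size w -> F (nth 0%N (0%N :: s ++ m :: t))
     = tower_weight q s m * (q ^+ (m ^ 2) * top_chain q w m t)) ->
  (fun N => boxsum d N F) @ \oo -->
  qpoch_inf Q (Q ^+ 2) * qpoch_inf Q (Q ^+ 2) * qpoch_inf (Q ^+ 2) (Q ^+ 2) / qpoch_inf q q.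
Proof.
move=> q_lt1 Ew EQ Ed hF; apply: cvg_seq_eq (tower_series_cvg q_lt1 Ew EQ) => N.
rewrite boxsumE Ed nested_sum_cat; apply: eq_nested_sum => s size_s /=.
by apply: eq_bigr => m _; apply: eq_nested_sum => t size_t; rewrite hF.
Qed.

Theorem theorem7p2 (R : realType) (q : Cpx R) (a b : nat) (cfl : seq nat) :
  `|q| < 1 -> coprime a b -> (1 <= b)%N -> (b < a)%N -> is_cf a b cfl ->
  ((a < 2 * b)%N ->
     (fun K => boxsum (cf_d cfl) K (summandA cfl q)) @ \oo --> rhs a b q) /\
  ((2 * b <= a)%N ->
     (fun K => boxsum (cf_d cfl) K (summandB cfl q)) @ \oo --> rhs a b q).
Proof.
move=> q_lt1 cop_ab b_gt0 lt_ba [cfl_neq0 cfl_pos Ecf _].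
have [Ecv cop_s] := cfvalE cfl_neq0 cfl_pos.
have /andP[] := slope_gt0 (cf_word cfl).
move: Ecv cop_s; case Es: (slope (cf_word cfl)) => [u v] /= Ecv cop_uv u_gt0 v_gt0.
have cop_d : coprime (a - b) b.
  by rewrite coprime_sym /coprime -gcdnDl subnKC ?(ltnW lt_ba) // gcdnC.
have ab_gt0 : (0 < a - b)%N by rewrite subn_gt0.
have b0 : b%:R != 0 :> rat by rewrite pnatr_eq0 -lt0n.
have ratio : a%:R / b%:R - 1 = (a - b)%N%:R / b%:R :> rat.
  by rewrite natrB ?(ltnW lt_ba) // mulrBl divff.
have rhsE c : c = (a * b)%N -> rhs a b q = let Q := q ^+ c in
   qpoch_inf Q (Q ^+ 2) * qpoch_inf Q (Q ^+ 2) * qpoch_inf (Q ^+ 2) (Q ^+ 2) / qpoch_inf q q.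
  by move=> -> /=; rewrite /rhs -exprM [(a * b * 2)%N]mulnC.
split=> hab.
  (* Here the continued fraction represents b / (a - b), and u(v + u) = ab. *)
  have [Eu Ev] : u = b /\ v = (a - b)%N.
    apply: coprime_ratio_eq => //; first by rewrite coprime_sym.
    move: Ecf; rewrite Ecv /cf_target /cf_sign ltnNge (ltnW hab) /= hab => ->.
    by rewrite ratio exprN1 invf_div.
  (* For d <= 1 the word is empty, and its slope (1, 1) gives b = 1 and a = 2, against a < 2b. *)
  have d_gt1 : (1 < cf_d cfl)%N.
    rewrite ltnNge; apply/negP => d_le1; move: Es; rewrite /cf_word (_ : (sumn cfl).-1 = 0)%N.
      by move=> [E1 E2]; lia.
    by move: d_le1; rewrite /cf_d; lia.
  rewrite (rhsE (u * (v + 1 * u))%N); last by rewrite Eu Ev; lia.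
  apply: (boxsum_tower_cvg (k := 0) q_lt1 Es erefl) => [|s m t size_s size_t].
    by rewrite size_map size_iota prednK //; exact: ltnW.
  by rewrite (size0nil size_s) mul1r summandA_chain // size_t size_map size_iota.
(* For a = 2b the target is a zeroth power, hence 1, which agrees with (a - b) / b. *)
have [Eu Ev] : u = (a - b)%N /\ v = b.
  apply: coprime_ratio_eq => //.
  move: Ecf; rewrite Ecv /cf_target /cf_sign ratio [(a < _)%N]ltnNge hab /=.
  case: ltnP => [_ ->|le_a2b ->]; first by rewrite expr1z.
  by rewrite expr0z (_ : (a - b = b)%N) ?divff //; lia.
case: cfl cfl_neq0 cfl_pos Es {Ecf Ecv} => // x c cfl_neq0 cfl_pos Es.
have x_gt0 : (0 < x)%N by move: cfl_pos => /andP[].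
(* A single quotient x forces b = 1 and x = a - 1, so the exponent 1 + x is ab. *)
have [c0|c_neq0] := eqVneq c [::].
  move: Es cfl_neq0; rewrite c0 cf_word1 // => -[Eu' Ev'] cfl_neq0.
  rewrite (rhsE (1 * (1 + x.-1.+1 * 1))%N); last by rewrite prednK // !mul1n muln1; nia.
  apply: (boxsum_tower_cvg (k := x.-1) (w := [::]) q_lt1 erefl erefl) => [|s m t size_s size_t].
    by rewrite /cf_d /= addn0 addn1 prednK.
  by rewrite (size0nil size_t) summandB_single.
have c_pos : all (fun x => 0 < x)%N c by move: cfl_pos => /andP[].
have c_gt0 : (0 < sumn c)%N by case: (c) c_neq0 c_pos => //= y c' _ /andP[]; lia.
move: Es; rewrite slope_cf_word //; case Es: (slope (cf_word c)) => [g e] [Eu' Ev'].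
(* From xg + e = a - b and g = b follows e + (x+1)g = a. *)
rewrite (rhsE (g * (e + x.+1 * g))%N); last by move: Eu' Ev'; rewrite /=; nia.
apply: (boxsum_tower_cvg (k := x) q_lt1 Es erefl) => [|s m t size_s size_t].
  by rewrite size_map size_iota prednK.
exact: (@summandB_chain R q (x :: c) cfl_neq0 c).
Qed.
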